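(* Let $\Delta$ be a countable distance value set with $\inf\Delta=0$. Then $\mathrm{Iso}(\mathbb{U}_\Delta)$ has the strong Lévy property. Moreover, there is a topology $\tau$ on Hall's universal locally finite group $\mathbb{H}$ such that $(\mathbb{H},\tau)$ is a topological group with the Lévy property.
   Context: All topological spaces (in particular all topological groups) are assumed Hausdorff. A topological group $G$ has the Lévy property if there is an increasing sequence $(K_i)_{i\in\mathbb{N}}$ of compact subgroups of $G$, with normalized Haar measures $\mu_i$ on $K_i$ (regarded as measures on $G$), such that (i) $\bigcup_i K_i$ is dense in $G$, and (ii) for each open neighborhood $V$ of the identity of $G$ and each sequence of Borel sets $A_i\subseteq K_i$ with $\liminf_i\mu_i(A_i)>0$, one has $\lim_i\mu_i(VA_i)=1$. $G$ has the strong Lévy property if such a sequence can be chosen with every $K_i$ finite (and $\mu_i$ the normalized counting measure). A distance value set is a nonempty set $\Delta$ of positive real numbers such that $\min\{x+y,\sup\Delta\}\in\Delta$ for all $x,y\in\Delta$ (where $\sup\Delta$ may be $+\infty$). A $\Delta$-metric space is a metric space whose nonzero distances all belong to $\Delta$. For countable $\Delta$, $\mathbb{U}_\Delta$ (the Urysohn $\Delta$-metric space) is the unique, up to isometry, countable $\Delta$-metric space that contains an isometric copy of every finite $\Delta$-metric space and is ultrahomogeneous (every isometry between finite subspaces extends to an isometry of $\mathbb{U}_\Delta$ onto itself). $\mathrm{Iso}(\mathbb{U}_\Delta)$ is the group of all isometries of $\mathbb{U}_\Delta$ onto itself, with the topology of pointwise convergence where $\mathbb{U}_\Delta$ carries its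 metric topology: basic open neighborhoods of the identity are $\{g : d_{\mathbb{U}_\Delta}(x_i,g(x_i))<\epsilon,\ i=1,\dots,n\}$ for $x_1,\dots,x_n\in\mathbb{U}_\Delta$, $\epsilon>0$. Hall's group $\mathbb{H}$ is the unique, up to isomorphism, countable locally finite group $H$ such that for any finite groups $F_1,F_2$ and group embeddings $\varphi\colon F_1\to H$, $i\colon F_1\to F_2$, there is a group embedding $\Phi\colon F_2\to H$ with $\varphi=\Phi\circ i$. (A group is locally finite if every finitely generated subgroup is finite.) *)

(* Defs.v *)
From HB Require Import structures.
From mathcomp Require Import all_boot all_order all_algebra all_fingroup finmap.
From mathcomp Require Import all_classical all_reals all_analysis.

Set Implicit Arguments.
Unset Strict Implicit.
Unset Printing Implicit Defensive.

Import Order.TTheory GRing.Theory Num.Theory.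
Import metricType_numDomainType.

Local Open Scope classical_set_scope.
Local Open Scope ring_scope.

HB.structure Definition PreTopologicalGroup :=
  {G of Topological G & monoid.Group G}.

HB.mixin Record PreTopologicalGroup_isTopologicalGroup G
    & PreTopologicalGroup G := {
  mulg_continuous : continuous (fun x : G * G => (x.1 * x.2)%g) ;
  invg_continuous : continuous (fun x : G => x^-1%g) ;
  topgroup_hausdorff : hausdorff_space G
}.

#[short(type="topologicalGroupType")]
HB.structure Definition TopologicalGroup :=
  {G of PreTopologicalGroup G & PreTopologicalGroup_isTopologicalGroup G}.

(* A group pointed at its identity: measurable types are required to be
   pointed. *)
Definition group_pointed (G : Type) : Type := G.
HB.instance Definition _ (G : groupType) := Choice.on (group_pointed G).
HB.instance Definition _ (G : groupType) :=
  isPointed.Build (group_pointed G) (1%g : G).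

Definition borel (G : topologicalGroupType) :=
  g_sigma_algebraType (@open G : set (set (group_pointed G))).

Definition subgroup (G : groupType) (K : set G) := group_closed [in K].

Section levy.
Variables (R : realType) (G : topologicalGroupType).

(* Haar measure on the compact subgroup K, extended by zero to the Borel sets
   of G. Regularity is part of the definition: without it invariance does not
   determine the measure when G is not second countable. *)
Definition normalized_haar (K : set G) (mu : probability (borel G) R) :=
  [/\ mu K = 1%E,
      forall (k : G) (A : set G), K k -> measurable (A : set (borel G)) ->
        mu [set (k * a)%g | a in A] = mu A
    & forall A : set G, measurable (A : set (borel G)) ->
        mu A = ereal_sup [set mu C | C in [set C | compact C /\ C `<=` A]] ].

Definition normalized_counting (K : set G) (mu : probability (borel G) R) :=
  forall A : set G, measurable (A : set (borel G)) ->
    mu A = (#|` fset_set (A `&` K)|%:R / #|` fset_set K|%:R)%:E.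

Definition levy_sequence (K : nat -> set G)
    (mu : nat -> probability (borel G) R) :=
  [/\ forall i, subgroup (K i) /\ compact (K i),
      forall i, K i `<=` K i.+1,
      dense (\bigcup_i K i)
    & forall (V : set G) (A : nat -> set G), open V -> V 1%g ->
        (forall i, measurable (A i : set (borel G)) /\ A i `<=` K i) ->
        (0 < limn_einf (fun i => mu i (A i)))%E ->
        mu i [set (v * a)%g | v in V & a in A i] @[i --> \oo] --> 1%E].

Definition levy := exists (K : nat -> set G) (mu : nat -> probability (borel G) R),
  levy_sequence K mu /\ forall i, normalized_haar (K i) (mu i).

Definition strong_levy := exists (K : nat -> set G) (mu : nat -> probability (borel G) R),
  levy_sequence K mu /\
  forall i, finite_set (K i) /\ normalized_counting (K i) (mu i).

End levy.

Section isometries.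
Variable R : realType.

Definition isometric (M N : metricType R) (f : M -> N) :=
  forall x y, mdist (f x) (f y) = mdist x y.

Variable M : metricType R.

Record isometry_group := Isometry {
  isometry_fun :> M -> M ;
  isometryP : isometric isometry_fun ;
  isometry_bij : bijective isometry_fun }.

HB.instance Definition _ := gen_eqMixin isometry_group.
HB.instance Definition _ := gen_choiceMixin isometry_group.

Lemma isometry_ext (f g : isometry_group) : f =1 g -> f = g.
Proof.
case: f g => [f fi fb] [g gi gb] /= /funext fg.
by subst g; congr Isometry; exact: Prop_irrelevance.
Qed.

Lemma id_isometric : isometric (@id M). Proof. by []. Qed.

Definition isometry_id := Isometry id_isometric (inv_bij (@frefl _ _ id)).

Lemma comp_isometric (f g : isometry_group) : isometric (f \o g).
Proof. by move=> x y /=; rewrite !isometryP. Qed.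

Definition isometry_comp (f g : isometry_group) :=
  Isometry (comp_isometric f g) (bij_comp (isometry_bij f) (isometry_bij g)).

Lemma isometry_inv_ex (f : isometry_group) :
  exists g : isometry_group, cancel f g /\ cancel g f.
Proof.
have [g fK gK] := isometry_bij f.
have gi : isometric g by move=> x y; rewrite -(isometryP f) !gK.
by exists (Isometry gi (Bijective gK fK)).
Qed.

Definition isometry_inv (f : isometry_group) := sval (cid (isometry_inv_ex f)).

Lemma isometryK (f : isometry_group) : cancel f (isometry_inv f).
Proof. by rewrite /isometry_inv; case: cid => g []. Qed.

Lemma isometryVK (f : isometry_group) : cancel (isometry_inv f) f.
Proof. by rewrite /isometry_inv; case: cid => g []. Qed.

Lemma isometry_compA : associative isometry_comp.
Proof. by move=> f g h; exact: isometry_ext. Qed.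
Lemma isometry_comp1f : left_id isometry_id isometry_comp.
Proof. by move=> f; exact: isometry_ext. Qed.
Lemma isometry_compf1 : right_id isometry_id isometry_comp.
Proof. by move=> f; exact: isometry_ext. Qed.
Lemma isometry_compVf : left_inverse isometry_id isometry_inv isometry_comp.
Proof. by move=> f; apply: isometry_ext => x /=; rewrite isometryK. Qed.
Lemma isometry_compfV : right_inverse isometry_id isometry_inv isometry_comp.
Proof. by move=> f; apply: isometry_ext => x /=; rewrite isometryVK. Qed.

HB.instance Definition _ := isGroup.Build isometry_group isometry_compA
  isometry_comp1f isometry_compf1 isometry_compVf isometry_compfV.

HB.instance Definition _ := Topological.copy isometry_group
  (initial_topology (isometry_fun : isometry_group -> {ptws M -> M})).

Lemma isometry_eval_continuous (x : M) : continuous (fun f : isometry_group => f x).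
Proof.
move=> f; have cf : {ptws, isometry_fun @ f --> isometry_fun f}.
  exact: (@initial_continuous _ _ (isometry_fun : isometry_group -> {ptws M -> M})).
exact: ((pointwise_cvgP _ (fmap_filter _ _)).1 cf x).
Qed.

Lemma isometry_continuous (T : topologicalType) (h : T -> isometry_group) :
  (forall x, continuous (fun t => h t x)) -> continuous h.
Proof.
move=> hc; apply: (@continuous_comp_initial _ _ _
  (isometry_fun : isometry_group -> {ptws M -> M})) => t.
by apply/pointwise_cvgP => x; exact: hc.
Qed.

Lemma isometry_mul_continuous :
  continuous (fun x : isometry_group * isometry_group => (x.1 * x.2)%g).
Proof.
apply: isometry_continuous => x [f g].
apply/cvgrPdist_lt => e e0.
have e20 : 0 < e / 2 by rewrite divr_gt0.
have /cvgrPdist_lt/(_ _ e20) cf := @isometry_eval_continuous (g x) f.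
have /cvgrPdist_lt/(_ _ e20) cg := @isometry_eval_continuous x g.
exists ([set f' : isometry_group | mdist (f (g x)) (f' (g x)) < e / 2],
        [set g' : isometry_group | mdist (g x) (g' x) < e / 2]) => //=.
move=> [f' g'] /= [ff' gg'].
rewrite (splitr e) (le_lt_trans (metric_triangle _ (f' (g x)) _))//.
by rewrite ltrD// isometryP.
Qed.

Lemma isometry_inv_continuous : continuous (fun f : isometry_group => f^-1%g).
Proof.
apply: isometry_continuous => x f.
apply/(@cvgrPdist_lt _ _ _ _ (nbhs_filter f)) => e e0.
have /cvgrPdist_lt/(_ _ e0) := @isometry_eval_continuous ((f^-1)%g x) f.
apply: (@filterS _ (nbhs f) (nbhs_filter f)) => f' /=.
have -> : f (f^-1%g x) = x by exact: isometryVK.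
rewrite -(isometryP f' (f^-1%g x)).
have -> : f' (f'^-1%g x) = x by exact: isometryVK.
by rewrite metric_sym.
Qed.

Lemma isometry_hausdorff : hausdorff_space isometry_group.
Proof.
rewrite open_hausdorff => f g /eqP fg.
have [x fgx] : exists x, f x != g x.
  apply: contrapT => /forallNP fgE; apply: fg; apply: isometry_ext => x.
  by apply/eqP; have /negP/negPn := fgE x.
have := @metric_hausdorff _ M; rewrite open_hausdorff => /(_ _ _ fgx).
move=> [[A B]/= [fA gB] [oA oB AB0]].
have ec := @isometry_eval_continuous x.
exists ((fun h : isometry_group => h x) @^-1` A, (fun h : isometry_group => h x) @^-1` B).
  by split; rewrite inE /=; [move: fA|move: gB]; rewrite inE.
split; [by move/continuousP : ec; exact|by move/continuousP : ec; exact|].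
by rewrite -preimage_setI (eqP AB0) preimage_set0.
Qed.

HB.instance Definition _ :=
  PreTopologicalGroup_isTopologicalGroup.Build isometry_group
    isometry_mul_continuous isometry_inv_continuous isometry_hausdorff.

End isometries.

Section urysohn.
Variables (R : realType) (Delta : set R).

(* The supremum is taken in the extended reals, so that it is +oo when Delta is
   unbounded. *)
Definition distance_value_set :=
  [/\ Delta !=set0,
      forall x, Delta x -> 0 < x
    & forall x y, Delta x -> Delta y ->
        [set z%:E | z in Delta]
          (mine (x + y)%:E (ereal_sup [set z%:E | z in Delta]))].

Definition Delta_metric (M : metricType R) :=
  forall x y : M, mdist x y != 0 -> Delta (mdist x y).

Definition urysohn_space (U : metricType R) :=
  [/\ countable [set: U],
      Delta_metric U,
      forall F : metricType R, finite_set [set: F] -> Delta_metric F ->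
        exists f : F -> U, isometric f
    & forall (A : set U) (f : U -> U), finite_set A ->
        {in A &, forall x y, mdist (f x) (f y) = mdist x y} ->
        exists g : isometry_group U, {in A, g =1 f}].

End urysohn.

Definition locally_finite_group (H : groupType) :=
  forall S : set H, finite_set S -> finite_set (smallest (@subgroup H) S).

Definition group_embedding (G H : groupType) (f : G -> H) :=
  injective f /\ {morph f : x y / (x * y)%g}.

Definition hall_group (H : groupType) :=
  [/\ countable [set: H],
      locally_finite_group H
    & forall (F1 F2 : finGroupType) (phi : F1 -> H) (i : F1 -> F2),
        group_embedding phi -> group_embedding i ->
        exists Phi : F2 -> H, group_embedding Phi /\ phi = Phi \o i].

(* Main.v *)
(** Give a finite group K a length function l with values in Delta and the
    left-invariant metric d(x, y) = l(x^-1 y). Two extensions of (K, l) to a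
    larger finite group do all the work.

    Power: embed K diagonally in K^n with the averaged length. By the
    Efron-Stein inequality for the Hamming metric, two subsets of K^n of
    non-negligible size are close to each other even after conjugation by any
    element of K, once n is large; this gives the Lévy property.

    Adjunction of t: given prescribed distances d(a, t b) extending the metric
    of K to the disjoint union of K and tK, the free product of K and <t> carries
    a path metric in which every use of t costs at least some positive constant.
    Since distances are truncated, only the words of bounded length matter, and
    letting K and t act on them yields a finite quotient with the right
    distances. This realizes one-point extensions and, up to an arbitrarily small
    error, partial isometries.

    The averaged and path lengths are real valued; as the set of truncated sums
    of finitely many elements of Delta is finite and closed under truncated
    addition, rounding up into it preserves the triangle inequality.

    Inside U, alternating the two extensions gives a chain of finite groups whose
    union is U itself; it acts on U by left translations and is dense in Iso(U).
    Inside Hall's group, alternating powers with the addition of one element at a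
    time exhausts the group, which gets the topology of its left translation
    action on the limit metric. *)
Require Import Defs.
From HB Require Import structures.
From mathcomp Require Import all_boot all_order all_algebra all_fingroup finmap.
From mathcomp Require Import all_classical all_reals all_analysis.
From mathcomp Require Import ring lra.

Set Implicit Arguments.
Unset Strict Implicit.
Unset Printing Implicit Defensive.

Import Order.TTheory GRing.Theory Num.Theory.

Local Open Scope classical_set_scope.
Local Open Scope ring_scope.

(** * Rounding length functions into a distance value set *)

Section rounding.
Variable R : realType.
Implicit Types Delta : set R.

(** The cap is any element [D] of [Delta] instead of the supremum, so that bounded and unbounded
    sets are treated alike within the reals. *)
Definition capped_sum_closed Delta :=
  (forall x, Delta x -> 0 < x) /\
  (forall D x y, Delta D -> Delta x -> Delta y -> Delta (Num.min D (x + y))).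

Lemma min_mem Delta x y : Delta x -> Delta y -> Delta (Num.min x y).
Proof. by case: leP. Qed.

Lemma min_min_addl (D x y : R) : 0 <= y ->
  Num.min D (Num.min D x + y) = Num.min D (x + y).
Proof.
move=> y0; case: (leP D x) => // Dx.
by rewrite !(min_idPl _)//; lra.
Qed.

Lemma distance_value_set_capped Delta :
  distance_value_set Delta -> capped_sum_closed Delta.
Proof.
move=> [_ D0 DD]; split=> // D x y dD dx dy.
have [z dz zE] := DD x y dx dy.
have [xyS|Sxy] := leP (x + y)%:E (ereal_sup [set z%:E | z in Delta]).
  move: zE; rewrite (min_idPl xyS) => -[<-]; exact: min_mem.
rewrite (_ : Num.min _ _ = D)//; apply/min_idPl; rewrite -lee_fin.
apply: le_trans (ltW Sxy); apply: ereal_sup_ubound; by exists D.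
Qed.

(** Truncating a partial sum at [D] before adding the next term does not change the truncated total.
    The value 0 is kept apart because it never lies in [Delta]. *)
Lemma capped_sum_exists Delta (I : Type) (s : seq I) (P : pred I) (F : I -> R) D :
  capped_sum_closed Delta -> Delta D ->
  (forall i, P i -> F i = 0 \/ 0 < F i /\ Delta (Num.min D (F i))) ->
  let x := \sum_(i <- s | P i) F i in x = 0 \/ 0 < x /\ Delta (Num.min D x).
Proof.
move=> [Dp Dc] dD h /=.
apply: (big_ind (fun x => x = 0 \/ 0 < x /\ Delta (Num.min D x))) => //.
  by left.
move=> x y [->|[x0 dx]]; first by rewrite add0r.
move=> [->|[y0 dy]]; first by rewrite addr0; right.
right; split; first exact: addr_gt0.
have := Dc _ _ _ dD dx dy; congr Delta.
rewrite min_min_addl; last by rewrite le_min !ltW//; exact: Dp.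
by rewrite [x + _]addrC min_min_addl ?[y + x]addrC// ltW.
Qed.

(** [r] rounds up to the least nonempty sum of elements of [V], truncated at [D]. These values form
    a finite set closed under truncated addition, whence the subadditivity. *)
Lemma exists_rounding Delta (V : seq R) (D : R) :
  capped_sum_closed Delta -> Delta D -> (forall v, v \in V -> Delta v /\ v <= D) ->
  exists r : R -> R, [/\ forall x, Delta (r x), forall x, x <= D -> x <= r x,
    forall x v, v \in V -> x <= v -> r x <= v
    & forall x y z, z <= x + y -> r z <= r x + r y].
Proof.
move=> hD dD hV; have [Dp Dc] := hD.
have D0 := Dp _ dD.
pose v (i : 'I_(size V)) := nth 0 V i.
have vV i : v i \in V by rewrite mem_nth.
have v0 i : 0 < v i by apply: Dp; exact: (hV _ (vV i)).1.
(* Multiplicity [N.+1] of a single element already reaches [D], so multiplicities up to [N.+1] yield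
   all truncated sums. *)
have [N hN] : exists N : nat, forall i, D <= v i *+ N.+1.
  pose n i := Num.bound (D / v i).
  exists (\max_i n i) => i.
  have := archi_boundP (divr_ge0 (ltW D0) (ltW (v0 i))).
  rewrite ltr_pdivrMr// mulr_natl => /ltW/le_trans; apply.
  by rewrite ler_pMn2l// (leq_trans (leq_bigmax (F := n) i)).
pose sm (f : {ffun 'I_(size V) -> 'I_N.+2}) := \sum_i v i *+ f i.
have smD f : 0 < sm f -> Delta (Num.min D (sm f)).
  rewrite /sm; have /= := @capped_sum_exists Delta _ (index_enum _) xpredT
    (fun i : 'I_(size V) => v i *+ f i) D hD dD.
  case=> [i _| -> |[]//]; last by rewrite ltxx.
  case: (nat_of_ord (f i)) => [|n]; first by left; rewrite mulr0n.
  right; split; first by rewrite pmulrn_lgt0.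
  elim: n => [|n IH].
    by rewrite mulr1n; apply: min_mem => //; exact: (hV _ (vV i)).1.
  have := Dc _ _ _ dD IH (hV _ (vV i)).1; congr Delta.
  by rewrite [in RHS]mulrSr min_min_addl// ltW.
(* The zero sum is excluded, so [r] is positive even at 0. *)
pose r x := \big[Num.min/D]_(f | (0 < sm f) && (x <= sm f)) Num.min D (sm f).
have rle x f : 0 < sm f -> x <= sm f -> r x <= sm f.
  move=> f0 xf; rewrite /r (bigD1 f) ?f0//= ge_min; apply/orP; left.
  by rewrite ge_min lexx orbT.
have rD x : r x <= D.
  rewrite /r; apply: (big_ind (fun y => y <= D)) => // [a b aD bD|f _].
    by rewrite ge_min aD.
  by rewrite ge_min lexx.
exists r; split.
- move=> x; apply: (big_ind Delta) => //; first exact: min_mem.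
  by move=> f /andP[f0 _]; exact: smD.
- move=> x xD; apply: (big_ind (fun y => x <= y)) => // [a b xa xb|f /andP[_ xf]].
    by rewrite le_min xa.
  by rewrite le_min xD.
- move=> x w wV xw.
  have iV : (index w V < size V)%N by rewrite index_mem.
  pose f : {ffun 'I_(size V) -> 'I_N.+2} :=
    [ffun i => if i == Ordinal iV then inord 1 else inord 0].
  have smf : sm f = w.
    rewrite /sm (bigD1 (Ordinal iV))//= big1 ?addr0.
      by rewrite ffunE eqxx inordK// mulr1n /v /= nth_index.
    by move=> i ni; rewrite ffunE (negPf ni) inordK// mulr0n.
  by rewrite -smf; apply: rle; rewrite smf//; apply: Dp; exact: (hV _ wV).1.
move=> x y z zxy.
have rE t : r t = D \/ exists2 f, [&& 0 < sm f & t <= sm f] & r t = Num.min D (sm f).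
  apply: (big_ind (fun u => u = D \/ exists2 f, [&& 0 < sm f & t <= sm f] & u = Num.min D (sm f))).
  - by left.
  - by move=> a b; case: leP.
  - by move=> f hf; right; exists f.
have r0 t : 0 < r t.
  by case: (rE t) => [->//|[f /andP[f0 _] ->]]; rewrite lt_min D0.
have rDz := rD z; have rx0 := r0 x; have ry0 := r0 y.
(* As [r z] is at most [D], only the case of two untruncated sums remains; their multiplicities then
   add up within range. *)
have [?|sD] := leP D (r x + r y); first lra.
case: (rE x) => [?|[f /andP[f0 xf] fE]]; first lra.
case: (rE y) => [?|[g /andP[g0 yg] gE]]; first lra.
have {}fE : r x = sm f by move: fE; case: (leP D); lra.
have {}gE : r y = sm g by move: gE; case: (leP D); lra.
pose h : {ffun 'I_(size V) -> 'I_N.+2} := [ffun i => inord (f i + g i)].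
have hE i : (h i : nat) = (f i + g i)%N.
  rewrite ffunE inordK//= ltnNge; apply/negP => lN.
  suff : D <= sm f + sm g by lra.
  rewrite /sm -big_split/= (bigD1 i)//= (le_trans (hN i))//.
  rewrite -mulrnDr ler_wpDr//.
    by apply: sumr_ge0 => j _; rewrite -mulrnDr mulrn_wge0// ltW.
  by rewrite ler_pMn2l// (leq_trans _ lN).
have smh : sm h = sm f + sm g.
  by rewrite /sm -big_split/=; apply: eq_bigr => i _; rewrite hE mulrnDr.
by rewrite fE gE -smh; apply: rle; rewrite smh; lra.
Qed.

End rounding.

(** * Group morphisms and length functions *)

Section group_morphisms.
Variables (G H : groupType) (f : G -> H).
Hypothesis fM : {morph f : x y / (x * y)%g}.

Lemma morph_group1 : f 1%g = 1%g.
Proof. by apply: (mulgI (f 1%g)); rewrite -fM !mulg1. Qed.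

Lemma morph_groupV x : f x^-1%g = (f x)^-1%g.
Proof. by apply: (mulgI (f x)); rewrite -fM !mulgV morph_group1. Qed.

End group_morphisms.

Section length_functions.
Variable R : realType.
Implicit Types (Delta : set R) (G : groupType).

Definition length_function G (l : G -> R) :=
  [/\ l 1%g = 0, forall x, l x^-1%g = l x
    & forall x y, l (x * y)%g <= l x + l y].

Definition length_in Delta G (l : G -> R) :=
  length_function l /\ forall x, x != 1%g -> Delta (l x).

Lemma length_ge0 G (l : G -> R) x : length_function l -> 0 <= l x.
Proof. by case=> l1 lV /(_ x x^-1%g); rewrite mulgV l1 lV; lra. Qed.

Lemma length_eq1 Delta G (l : G -> R) x : capped_sum_closed Delta ->
  length_in Delta l -> l x = 0 -> x = 1%g.
Proof.
move=> [Dp _] [_ lD] lx; apply: contrapT => /eqP/lD/Dp.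
by rewrite lx ltxx.
Qed.

Lemma length_dist_inj Delta G (l : G -> R) x y : capped_sum_closed Delta ->
  length_in Delta l -> l (x^-1 * y)%g = 0 -> x = y.
Proof.
move=> hD hl /(length_eq1 hD hl) xy.
by apply: (mulgI x^-1%g); rewrite xy mulVg.
Qed.

Lemma length_dist_sym G (l : G -> R) x y : length_function l ->
  l (x^-1 * y)%g = l (y^-1 * x)%g.
Proof. by case=> _ lV _; rewrite -lV invgM invgK. Qed.

Lemma length_dist_triangle G (l : G -> R) y x z : length_function l ->
  l (x^-1 * z)%g <= l (x^-1 * y)%g + l (y^-1 * z)%g.
Proof.
by case=> _ _ /(_ (x^-1 * y)%g (y^-1 * z)%g); rewrite mulgA mulgK.
Qed.

(** Composition with a rounding function keeps subadditivity and fixes the values in [V]. It sends 0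
    to a positive number, so the identity is treated apart, and [l] separates points even where [q]
    does not. *)
Lemma round_length Delta G (q : G -> R) (D : R) (V : seq R) :
  capped_sum_closed Delta -> length_function q -> Delta D ->
  (forall g, q g <= D) -> (forall v, v \in V -> Delta v /\ v <= D) ->
  exists l : G -> R, [/\ length_in Delta l, forall g, q g \in V -> l g = q g
    & forall g v, v \in V -> q g <= v -> l g <= v].
Proof.
move=> hD hq dD qD hV; have [q1 qV qM] := hq.
have [r [rD rge rle rM]] := exists_rounding hD dD hV.
have r0 x : 0 < r x by apply: hD.1; exact: rD.
exists (fun g => if g == 1%g then 0 else r (q g)); split.
- split; last by move=> x /negPf ->.
  split; first by rewrite eqxx.
    by move=> x; rewrite qV -(inj_eq invg_inj) invgK invg1.
  move=> x y; case: ifPn => [_|xy1]; first by rewrite addr_ge0//; case: ifP => // _; exact: ltW.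
  have [x1|x1] := eqVneq x 1%g.
    by move: xy1; rewrite x1 mul1g add0r => /negPf ->.
  have [y1|y1] := eqVneq y 1%g; first by rewrite y1 mulg1 addr0.
  exact: rM.
- move=> g gV; case: eqP => [->|_]; first by rewrite q1.
  by apply/eqP; rewrite eq_le rle//= rge.
- move=> g v vV gv; case: eqP => [_|_]; last exact: rle.
  by apply/ltW/hD.1; exact: (hV _ vV).1.
Qed.

End length_functions.

(** * Adjoining a new isometry to a finite group with a length function *)

Section free_extension.
Variables (R : realType) (K : finGroupType) (l : K -> R) (rho : K -> K -> R).
Variables (C delta : R) (N : nat).
Hypothesis length_l : length_function l.
Hypothesis l_leC : forall k, l k <= C.
Hypothesis rho_leC : forall a b, rho a b <= C.
Hypothesis delta_gt0 : 0 < delta.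
Hypothesis rho_ge : forall a b, delta <= rho a b.
Hypothesis rho_lipl : forall a a' b, rho a b <= l (a^-1 * a')%g + rho a' b.
Hypothesis rho_lipr : forall a b b', rho a b <= l (b^-1 * b')%g + rho a b'.
Hypothesis rho_trl : forall a a' b b',
  l (a^-1 * a')%g <= rho a b + l (b^-1 * b')%g + rho a' b'.
Hypothesis rho_trr : forall a a' b b',
  l (b^-1 * b')%g <= rho a b + l (a^-1 * a')%g + rho a' b'.
Hypothesis N_large : C <= delta *+ N.

(** With [rho a b] read as the distance from [a] to [t b], this is the length prescribed for
    [a^-1 t^s b], where [true] is the exponent 1 and [false] the exponent -1. The inequalities
    assumed for [l] and [rho] are the triangle inequalities on the union of [K] and [tK]. *)
Definition signed_rho (s : bool) a b := if s then rho a b else rho b a.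

Lemma signed_rhoN s a b : signed_rho (~~ s) a b = signed_rho s b a.
Proof. by case: s. Qed.

Lemma signed_rho_lipl s a a' b :
  signed_rho s a b <= l (a^-1 * a')%g + signed_rho s a' b.
Proof. by case: s => /=. Qed.

Lemma signed_rho_trr s a b b' :
  l (b^-1 * b')%g <= signed_rho s a b + signed_rho s a b'.
Proof.
have l1 : l (a^-1 * a)%g = 0 by rewrite mulVg; case: length_l.
case: s => /=; [have := rho_trr a a b b'|have := rho_trl b b' a a];
  by rewrite l1; lra.
Qed.

Local Notation word := (seq (bool * K)).

Definition reduced (p : word) :=
  sorted (fun x y => (x.2 != 1%g) || (x.1 == y.1)) p.

(* The pair (k, [:: (s1, k1); ...; (sn, kn)]) stands for the reduced element
   k t^s1 k1 ... t^sn kn of the free product of K with the infinite cyclic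
   group on t. *)
Definition good_word (r : K * word) := reduced r.2 && (size r.2 <= N)%N.

Definition wflip : word -> word := map (fun x => (~~ x.1, x.2)).

(* Left multiplication by t^s. The words of full length that should become
   longer are flipped instead, which turns it into a permutation. *)
Definition wpush (s : bool) (r : K * word) : K * word :=
  if (size r.2 < N)%N then (1%g, (s, r.1) :: r.2) else (r.1, wflip r.2).

Definition wmove (s : bool) (r : K * word) : K * word :=
  if r.2 is (s', k') :: p' then
    if (r.1 == 1%g) && (s' != s) then (k', p') else wpush s r
  else wpush s r.

Lemma reduced_flip p : reduced (wflip p) = reduced p.
Proof.
case: p => //= -[s k] p; rewrite path_map; by apply: eq_path => -[[] x] [[] y].
Qed.

Lemma good_wpush s k p : good_word (k, p) ->
  (if p is (s', _) :: _ then ~~ ((k == 1%g) && (s' != s)) else true) ->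
  good_word (wpush s (k, p)).
Proof.
rewrite /good_word /wpush /= => /andP[rp sp] h.
case: ltnP => /= hN; last by rewrite reduced_flip rp size_map.
rewrite hN andbT; case: p rp sp h hN => //= -[s' k'] p rp sp h _.
rewrite /reduced /= in rp *; rewrite rp andbT.
by move: h {rp}; case: (k == 1%g) => //=; case: s' => //; case: s.
Qed.

Lemma good_wmove s r : good_word r -> good_word (wmove s r).
Proof.
case: r => k [|[s' k'] p] g; rewrite /wmove /=; first exact: good_wpush.
case: ifPn => h; last exact: good_wpush.
move: g; rewrite /good_word /= => /andP[+ sp]; rewrite (ltnW sp) andbT.
exact: path_sorted.
Qed.

Lemma wmoveK s r : good_word r -> wmove (~~ s) (wmove s r) = r.
Proof.
have flipK : cancel wflip wflip.
  by move=> p; rewrite /wflip -map_comp map_id_in// => -[b x] _ /=; rewrite negbK.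
case: r => k [|[s' k'] p] g; rewrite /wmove /=.
  rewrite /wpush /=; case: ltnP => /= hN; first by rewrite eqxx; case: s {g}.
  by rewrite ltnNge hN.
case: ifPn => [/andP[/eqP k1 ss']|h].
  have {ss'} s'E : s' = ~~ s by move: ss'; case: (s); case: (s').
  move: g; rewrite /good_word /= s'E k1 => /andP[rp sp].
  case: p rp sp => [|[s'' k''] p] /=; first by rewrite /wpush /= => _ ->.
  move=> /andP[h _] sp; rewrite ifF; first by rewrite /wpush /= sp.
  by apply/negP => /andP[/eqP k'1 ss]; move: h ss; rewrite k'1 eqxx /= => /eqP <-; rewrite eqxx.
rewrite /wpush /=; case: ltnP => hN /=; first by rewrite eqxx; case: (s).
(* The full word was flipped. Flipping its signs together with [s] creates no cancellation, so the
   second move flips it back. *)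
rewrite ifF; last by apply: contraNF h; case: (s); case: (s').
by rewrite ltnNge size_map hN /= negbK flipK.
Qed.

(** The length of [k t^s k0 ...] in the path metric, truncated at [C]: the minimum runs over the
    factorizations [(k t^s x) (x^-1 k0 ...)], whose first factor has a prescribed length. *)
Fixpoint wdist (p : word) (k : K) : R :=
  if p is (s, k0) :: p' then
    \big[Num.min/C]_x (wdist p' (x^-1 * k0)%g + signed_rho s k^-1%g x)
  else l k.

Lemma C_ge0 : 0 <= C.
Proof. by apply: le_trans (l_leC 1%g); case: length_l => ->. Qed.

Lemma wdist_cons_ge s k0 p k c : c <= C ->
  (forall x, c <= wdist p (x^-1 * k0)%g + signed_rho s k^-1%g x) ->
  c <= wdist ((s, k0) :: p) k.
Proof.
move=> cC h; apply: (big_rec (fun y => c <= y)) => // x y _ hy.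
by rewrite le_min h.
Qed.

Lemma wdist_cons_le s k0 p k x :
  wdist ((s, k0) :: p) k <= wdist p (x^-1 * k0)%g + signed_rho s k^-1%g x.
Proof. by rewrite /= (bigD1 x)//= ge_min lexx. Qed.

Lemma wdist_leC p k : wdist p k <= C.
Proof.
case: p => [|[s k0] p] //=; apply: (big_rec (fun y => y <= C)) => // x y _ yC.
by rewrite ge_min yC orbT.
Qed.

(** Each letter costs at least [delta]. Hence all words of length [N] have the maximal length [C],
    and flipping their signs does not change it. *)
Lemma wdist_lb p k : Num.min C (delta *+ size p) <= wdist p k.
Proof.
elim: p k => [|[s k0] p IH] k; first by rewrite mulr0n ge_min length_ge0 ?orbT.
apply: wdist_cons_ge => [|x]; first by rewrite ge_min lexx.
have h1 := IH (x^-1 * k0)%g.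
have h2 : delta <= signed_rho s k^-1%g x by rewrite /signed_rho; case: s.
rewrite /= mulrS; move: h1; set d := delta *+ _; have dg := delta_gt0.
by case: (leP C d); case: (leP C (delta + d)); lra.
Qed.

Lemma wdist_full p k : (N <= size p)%N -> wdist p k = C.
Proof.
move=> Np; apply/eqP; rewrite eq_le wdist_leC /=.
apply: le_trans (wdist_lb p k); rewrite le_min lexx /=.
by rewrite (le_trans N_large)// ler_pMn2l.
Qed.

Lemma wdist_lip p a k : wdist p (a * k)%g <= l a + wdist p k.
Proof.
have l0 : 0 <= l a by exact: length_ge0.
case: p => [|[s k0] p]; first by case: length_l => _ _ ->.
rewrite -lerBlDl; apply: wdist_cons_ge => [|x].
  by have := wdist_leC ((s, k0) :: p) (a * k)%g; lra.
rewrite lerBlDl (le_trans (wdist_cons_le _ _ _ _ x))//.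
rewrite addrCA lerD2l (le_trans (signed_rho_lipl _ _ k^-1%g _))//.
by rewrite invgK mulgK.
Qed.

(** One bound uses the factorization through [b]; for the other, the triangle inequality through [a]
    compares any competitor [x] with [b]. *)
Lemma wdist_push s k p a b :
  `|wdist ((s, k) :: p) a^-1%g - wdist p (b^-1 * k)%g| <= signed_rho s a b.
Proof.
rewrite ler_distl; apply/andP; split; last first.
  by have := wdist_cons_le s k p a^-1%g b; rewrite invgK; lra.
apply: wdist_cons_ge => [|x].
  have := wdist_leC p (b^-1 * k)%g.
  have : 0 <= signed_rho s a b.
    by apply: le_trans (ltW delta_gt0) _; rewrite /signed_rho; case: s.
  by lra.
have := @wdist_lip p (b^-1 * x)%g (x^-1 * k)%g.
rewrite mulgA mulgK invgK => h.
by have := signed_rho_trr s a b x; lra.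
Qed.

(** A cancellation is a push of the opposite sign read backwards, and a flip leaves the length at
    [C]. *)
Lemma wdist_move s r a b : good_word r ->
  `|wdist (wmove s r).2 (a^-1 * (wmove s r).1)%g - wdist r.2 (b^-1 * r.1)%g|
    <= signed_rho s a b.
Proof.
case: r => k p g.
have hpush : `|wdist (wpush s (k, p)).2 (a^-1 * (wpush s (k, p)).1)%g -
    wdist p (b^-1 * k)%g| <= signed_rho s a b.
  rewrite /wpush /=; case: ltnP => hN; first by rewrite mulg1; exact: wdist_push.
  rewrite !wdist_full ?size_map// subrr normr0.
  by apply: le_trans (ltW delta_gt0) _; rewrite /signed_rho; case: s.
rewrite /wmove /=; case: p g hpush => [//|[s' k'] p] g hpush.
case: ifPn => // /andP[/eqP -> ss'] /=.
have -> : s' = ~~ s by move: ss'; case: (s); case: (s').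
by rewrite mulg1 distrC -(signed_rhoN s); exact: (@wdist_push (~~ s) k' p b a).
Qed.

(** Bounded sequences make the good words a finite type, so that their permutations form a finite
    group. *)
Definition wpoint := {w : K * {bseq N of bool * K} | reduced w.2}.

Definition rawpoint (w : wpoint) : K * word :=
  let: (k, p) := val w in (k, val p).

Lemma raw_good w : good_word (rawpoint w).
Proof.
by case: w => [[k p] rp]; rewrite /good_word /rawpoint /= size_bseq andbT.
Qed.

Lemma raw_inj : injective rawpoint.
Proof.
move=> [[k p] rp] [[k' p'] rp'] [/= kk' pp']; apply: val_inj => /=.
by congr pair => //; exact: val_inj.
Qed.

Lemma raw_surj r : good_word r -> exists w, rawpoint w = r.
Proof.
case: r => k p /andP[/= rp sp].
by exists (exist (fun w : K * {bseq N of _} => reduced w.2) (k, Bseq sp) rp).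
Qed.

Lemma lift_perm (f f' : K * word -> K * word) :
  (forall r, good_word r -> good_word (f r)) -> (forall r, good_word r -> f' (f r) = r) ->
  exists g : {perm wpoint}, forall w, rawpoint (g w) = f (rawpoint w).
Proof.
move=> fg fK.
have /choice[h hE] : forall w, exists w', rawpoint w' = f (rawpoint w).
  by move=> w; apply/raw_surj/fg/raw_good.
have hI : injective h.
  move=> w w' /(congr1 rawpoint); rewrite !hE => /(congr1 f').
  by rewrite !fK ?raw_good// => /raw_inj.
by exists (perm hI) => w; rewrite permE hE.
Qed.

(** Permutations compose from left to right, so [k] must act as left multiplication by [k^-1] to
    give a morphism; likewise [t] will act as [t^-1]. *)
Lemma wact_ex : exists phi : K -> {perm wpoint},
  forall k w, rawpoint (phi k w) = ((k^-1 * (rawpoint w).1)%g, (rawpoint w).2).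
Proof.
suff /choice[phi phiE] : forall k, exists g : {perm wpoint},
    forall w, rawpoint (g w) = ((k^-1 * (rawpoint w).1)%g, (rawpoint w).2) by exists phi.
move=> k; apply: (@lift_perm (fun r => ((k^-1 * r.1)%g, r.2))
  (fun r => ((k * r.1)%g, r.2))) => // r _ /=.
by rewrite mulKVg; case: r.
Qed.

Lemma wmove_ex : exists T : {perm wpoint},
  forall w, rawpoint (T w) = wmove false (rawpoint w).
Proof.
apply: (@lift_perm _ (wmove true)) => r; first exact: good_wmove.
exact: (@wmoveK false).
Qed.

Definition depth (w : wpoint) := wdist (rawpoint w).2 (rawpoint w).1.

(** Whatever the function [depth], the largest change it undergoes under a permutation is a length
    function. *)
Definition displacement (g : {perm wpoint}) : R :=
  \big[Num.max/0]_w `|depth (g w) - depth w|.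

Lemma displacement_le (g : {perm wpoint}) (c : R) : 0 <= c ->
  (forall w, `|depth (g w) - depth w| <= c) -> displacement g <= c.
Proof.
move=> c0 h; apply: (big_rec (fun y => y <= c)) => // w y _ yc.
by rewrite ge_max h.
Qed.

Lemma displacement_ge (g : {perm wpoint}) w : `|depth (g w) - depth w| <= displacement g.
Proof. by rewrite /displacement (bigD1 w)//= le_max lexx. Qed.

Lemma displacement_ge0 g : 0 <= displacement g.
Proof.
apply: (big_rec (fun y => 0 <= y)) => // w y _ y0.
by rewrite le_max y0 orbT.
Qed.

Lemma displacement_length : length_function displacement.
Proof.
have dV g : displacement g^-1%g <= displacement g.
  apply: displacement_le => [|w]; first exact: displacement_ge0.
  by have := displacement_ge g (g^-1%g w); rewrite permKV distrC.
split.
- apply/eqP; rewrite eq_le displacement_ge0 andbT.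
  by apply: displacement_le => // w; rewrite perm1 subrr normr0.
- by move=> g; apply/eqP; rewrite eq_le dV -{1}[g]invgK dV.
- move=> g h; apply: displacement_le => [|w].
    by rewrite addr_ge0// displacement_ge0.
  rewrite permM [leRHS]addrC.
  apply: le_trans (lerD (displacement_ge h (g w)) (displacement_ge g w)).
  by apply: le_trans (ler_normD _ _); rewrite addrA subrK.
Qed.

Lemma displacement_leC g : displacement g <= C.
Proof.
apply: displacement_le => [|w]; first exact: C_ge0.
have d0 v : 0 <= depth v.
  apply: le_trans (wdist_lb _ _); rewrite le_min C_ge0 /=.
  by rewrite mulrn_wge0// ltW.
rewrite ler_distlC; have := wdist_leC (rawpoint w).2 (rawpoint w).1.
have := wdist_leC (rawpoint (g w)).2 (rawpoint (g w)).1.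
by have := d0 w; have := d0 (g w); rewrite /depth => *; apply/andP; split; lra.
Qed.

(** The Lipschitz estimates on [depth] give the upper bounds. They are attained because [phi k]
    moves the identity to [k^-1], and the second permutation moves [a^-1 t b] to the identity. *)
Lemma free_displacement : (0 < N)%N ->
  exists (phi : K -> {perm wpoint}) (t : {perm wpoint}),
  [/\ {morph phi : x y / (x * y)%g}, forall k, displacement (phi k) = l k
    & forall a b, displacement ((phi a)^-1 * t * phi b)%g = rho a b].
Proof.
move=> N0; have [phi phiE] := wact_ex; have [t tE] := wmove_ex.
have phiM : {morph phi : x y / (x * y)%g}.
  move=> x y; apply/permP => w; rewrite permM; apply: raw_inj.
  by rewrite !phiE /= invgM mulgA.
have phiV x : ((phi x)^-1 = phi x^-1)%g by rewrite (morph_groupV phiM).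
have l1 : l 1%g = 0 by case: length_l.
exists phi, t; split => //.
  move=> k; apply/eqP; rewrite eq_le; apply/andP; split.
    apply: displacement_le => [|w]; first exact: length_ge0.
    rewrite /depth phiE /= ler_distlC.
    have h1 := wdist_lip (rawpoint w).2 k^-1%g (rawpoint w).1.
    have h2 := wdist_lip (rawpoint w).2 k (k^-1 * (rawpoint w).1)%g.
    rewrite mulKVg in h2; have [_ lV _] := length_l; rewrite lV in h1.
    by apply/andP; split; lra.
  have [w wE] : exists w, rawpoint w = (1%g, [::]) by exact: raw_surj.
  have := displacement_ge (phi k) w.
  by rewrite /depth phiE wE /= mulg1 l1 subr0 ger0_norm ?length_ge0//; case: length_l => _ ->.
move=> a b; apply/eqP; rewrite eq_le; apply/andP; split.
  apply: displacement_le => [|w].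
    by apply: le_trans (ltW delta_gt0) _.
  rewrite phiV /depth !permM phiE /= tE phiE /= invgK.
  have g : good_word ((a * (rawpoint w).1)%g, (rawpoint w).2) by exact: raw_good w.
  have := wdist_move false b a g; rewrite /= mulKg //.
have [w wE] : exists w, rawpoint w = (a^-1%g, [:: (true, b)]).
  by apply: raw_surj; rewrite /good_word /= N0.
have := displacement_ge ((phi a)^-1 * t * phi b)%g w.
rewrite phiV /depth !permM phiE /= tE phiE /= wE /= invgK mulgV.
rewrite /wmove /= eqxx /= mulVg l1 sub0r normrN.
move=> h; apply: le_trans h; apply: le_trans (ler_norm _).
apply: (big_rec (fun y => rho a b <= y)) => // x y _ hy.
by rewrite le_min hy andbT (length_dist_sym _ _ length_l).
Qed.

End free_extension.

(** * Extending a finite table of prescribed distances *)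

Section table_extension.
Variables (R : realType) (Delta : set R) (K : finGroupType) (l : K -> R).
Variables (s : seq (K * K * R)) (D : R).
Hypothesis Delta_capped : capped_sum_closed Delta.
Hypothesis length_l : length_in Delta l.
Hypothesis Delta_D : Delta D.
Hypothesis l_leD : forall k, l k <= D.
Hypothesis Delta_s : forall x, x \in s -> Delta x.2 /\ x.2 <= D.
Hypothesis s_trl : forall x y, x \in s -> y \in s ->
  l (x.1.1^-1 * y.1.1)%g <= x.2 + l (x.1.2^-1 * y.1.2)%g + y.2.
Hypothesis s_trr : forall x y, x \in s -> y \in s ->
  l (x.1.2^-1 * y.1.2)%g <= x.2 + l (x.1.1^-1 * y.1.1)%g + y.2.

(** The length of the path from [a] to [t b] that crosses from [K] to [tK] along the entry [x]. *)
Definition via (a b : K) (x : K * K * R) : R :=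
  l (a^-1 * x.1.1)%g + x.2 + l (x.1.2^-1 * b)%g.

Definition table_dist (a b : K) : R :=
  \big[Num.min/D]_(x <- s) Num.min D (via a b x).

Lemma table_dist_leD a b : table_dist a b <= D.
Proof.
apply: (big_rec (fun y => y <= D)) => // x y _ yD.
by rewrite ge_min yD orbT.
Qed.

Lemma table_dist_le a b x : x \in s -> table_dist a b <= via a b x.
Proof.
rewrite /table_dist; elim: s => // y s' IH; rewrite inE big_cons => /predU1P[->|xs].
  by rewrite !ge_min lexx !orbT.
by rewrite ge_min IH ?orbT.
Qed.

Lemma table_dist_ge a b c : c <= D -> (forall x, x \in s -> c <= via a b x) ->
  c <= table_dist a b.
Proof.
move=> cD h; rewrite /table_dist big_seq; apply: (big_rec (fun y => c <= y)) => //.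
by move=> x y xs cy; rewrite !le_min cy cD h.
Qed.

Lemma table_dist_cases a b :
  table_dist a b = D \/ exists2 x, x \in s & table_dist a b = via a b x.
Proof.
rewrite /table_dist big_seq.
apply: (big_rec (fun y => y = D \/ exists2 x, x \in s & y = via a b x)); first by left.
move=> x y xs hy; case: (leP _ y) => // _.
by case: (leP D (via a b x)) => _; [left|right; exists x].
Qed.

Lemma length_1_or_in k : k = 1%g \/ Delta (l k).
Proof.
have [-> | k1] := eqVneq k 1%g; first by left.
by right; case: length_l => _; exact.
Qed.

Lemma Delta_min_add y k : Delta (Num.min D y) -> Delta (Num.min D (y + l k)).
Proof.
have [l1 _ _] := length_l.1.
move=> dy; case: (length_1_or_in k) => [->|dk]; first by rewrite l1 addr0.
rewrite -min_min_addl; first exact: Delta_capped.2.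
by apply/ltW/Delta_capped.1.
Qed.

Lemma table_dist_Delta a b : Delta (table_dist a b).
Proof.
rewrite /table_dist big_seq; apply: (big_ind Delta) => // [|x xs].
  exact: min_mem.
apply: Delta_min_add; rewrite addrC; apply: Delta_min_add.
by apply: min_mem => //; exact: (Delta_s xs).1.
Qed.

Lemma table_dist_gt0 a b : 0 < table_dist a b.
Proof. by apply: Delta_capped.1; exact: table_dist_Delta. Qed.

Lemma table_dist_lipl a a' b :
  table_dist a b <= l (a^-1 * a')%g + table_dist a' b.
Proof.
rewrite -lerBlDl; apply: table_dist_ge => [|x xs].
  have := table_dist_leD a b; have := length_ge0 (a^-1 * a')%g length_l.1; lra.
have := table_dist_le a b xs.
have := length_dist_triangle a' a x.1.1 length_l.1.
by rewrite /via; lra.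
Qed.

Lemma table_dist_lipr a b b' :
  table_dist a b <= l (b^-1 * b')%g + table_dist a b'.
Proof.
rewrite -lerBlDl; apply: table_dist_ge => [|x xs].
  have := table_dist_leD a b; have := length_ge0 (b^-1 * b')%g length_l.1; lra.
have := table_dist_le a b xs.
have := length_dist_triangle b' x.1.2 b length_l.1.
by rewrite (length_dist_sym b' b length_l.1) /via; lra.
Qed.

(** If one of the two distances is [D], the bound on [l] suffices. Otherwise both run along entries
    [x] and [y], whose compatibility closes the polygon. *)
Lemma table_dist_trl a a' b b' :
  l (a^-1 * a')%g <= table_dist a b + l (b^-1 * b')%g + table_dist a' b'.
Proof.
have hl := length_l.1.
have := table_dist_gt0 a b; have := table_dist_gt0 a' b'.
have := length_ge0 (b^-1 * b')%g hl; have := l_leD (a^-1 * a')%g.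
case: (table_dist_cases a b) => [->|[x xs ->]]; first by lra.
case: (table_dist_cases a' b') => [->|[y ys ->]]; first by lra.
have := s_trl xs ys; rewrite /via.
have := length_dist_triangle x.1.1 a a' hl.
have := length_dist_triangle y.1.1 x.1.1 a' hl.
have := length_dist_triangle b x.1.2 y.1.2 hl.
have := length_dist_triangle b' b y.1.2 hl.
rewrite (length_dist_sym y.1.1 a' hl) (length_dist_sym b' y.1.2 hl); lra.
Qed.

Lemma table_dist_trr a a' b b' :
  l (b^-1 * b')%g <= table_dist a b + l (a^-1 * a')%g + table_dist a' b'.
Proof.
have hl := length_l.1.
have := table_dist_gt0 a b; have := table_dist_gt0 a' b'.
have := length_ge0 (a^-1 * a')%g hl; have := l_leD (b^-1 * b')%g.
case: (table_dist_cases a b) => [->|[x xs ->]]; first by lra.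
case: (table_dist_cases a' b') => [->|[y ys ->]]; first by lra.
have := s_trr xs ys; rewrite /via.
have := length_dist_triangle x.1.2 b b' hl.
have := length_dist_triangle y.1.2 x.1.2 b' hl.
have := length_dist_triangle a x.1.1 y.1.1 hl.
have := length_dist_triangle a' a y.1.1 hl.
rewrite (length_dist_sym b x.1.2 hl) (length_dist_sym x.1.1 a hl).
rewrite (length_dist_sym a' y.1.1 hl) => *.
by move: (length_dist_sym a' y.1.1 hl) => *; lra.
Qed.

Lemma table_extension_capped :
  exists (K' : finGroupType) (phi : K -> K') (t : K') (l' : K' -> R),
  [/\ {morph phi : x y / (x * y)%g}, length_in Delta l',
      forall k, l' (phi k) = l k
    & forall a b, l' ((phi a)^-1 * t * phi b)%g = table_dist a b].
Proof.
pose delta := \big[Num.min/D]_(p : K * K) table_dist p.1 p.2.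
have delta0 : 0 < delta.
  apply: (big_ind (fun x => 0 < x)); first exact: Delta_capped.1.
    by move=> x y x0 y0; rewrite lt_min x0.
  by move=> p _; exact: table_dist_gt0.
have deltale a b : delta <= table_dist a b.
  by rewrite /delta (bigD1 (a, b))//= ge_min lexx.
(* [N] is positive, and [N] uses of [t] cost at least [D]. *)
pose N := (Num.bound (D / delta)).+1.
have hN : D <= delta *+ N.
  have := archi_boundP (divr_ge0 (ltW (Delta_capped.1 _ Delta_D)) (ltW delta0)).
  rewrite ltr_pdivrMr// mulr_natl => /ltW/le_trans; apply.
  by rewrite ler_pMn2l.
have [phi [t [phiM phil phit]]] := @free_displacement R K l table_dist D delta N
  length_l.1 l_leD table_dist_leD delta0 deltale table_dist_lipl table_dist_lipr
  table_dist_trl table_dist_trr hN isT.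
(* Rounding fixes the elements of [V], so the lengths on [K] and the prescribed distances
   survive. *)
pose V := [seq l k | k <- enum K & k != 1%g] ++ [seq table_dist p.1 p.2 | p : K * K].
have hV v : v \in V -> Delta v /\ v <= D.
  rewrite mem_cat => /orP[/mapP[k]|/mapP[p _ ->]].
    by rewrite mem_filter => /andP[k1 _] ->; split => //; exact: length_l.2.
  by split; [exact: table_dist_Delta|exact: table_dist_leD].
have [l' [l'D l'E _]] := round_length Delta_capped (displacement_length l table_dist D N)
  Delta_D (displacement_leC length_l.1 l_leD delta0 deltale) hV.
exists {perm (wpoint K N)}, phi, t, l'; split => // [k|a b].
  have [->|k1] := eqVneq k 1%g.
    rewrite (morph_group1 phiM).
    by case: l'D => -[-> _ _] _; case: length_l => -[-> _ _] _.
  rewrite -phil l'E// mem_cat; apply/orP; left; apply/mapP; exists k => //.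
  by rewrite mem_filter k1 mem_enum.
rewrite -phit l'E// mem_cat; apply/orP; right; apply/mapP.
by exists (a, b) => //; rewrite mem_enum.
Qed.

End table_extension.

(* The triple (a, b, w) demands that the new element t moves b to within
   distance w of a. *)
Lemma table_extension (R : realType) (Delta : set R) (K : finGroupType)
    (l : K -> R) (s : seq (K * K * R)) :
  capped_sum_closed Delta -> Delta !=set0 -> length_in Delta l ->
  (forall x, x \in s -> Delta x.2) ->
  (forall x y, x \in s -> y \in s ->
    `|l (x.1.1^-1 * y.1.1)%g - l (x.1.2^-1 * y.1.2)%g| <= x.2 + y.2) ->
  exists (K' : finGroupType) (phi : K -> K') (t : K') (l' : K' -> R),
  [/\ {morph phi : x y / (x * y)%g}, length_in Delta l',
      forall k, l' (phi k) = l k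
    & forall x, x \in s ->
        let d := l' ((phi x.1.1)^-1 * t * phi x.1.2)%g in
        d <= x.2 /\
        ((forall y, y \in s -> x.2 <= via l x.1.1 x.1.2 y) -> d = x.2)].
Proof.
move=> hD [D0 dD0] hl sD str.
have l1 : l 1%g = 0 by case: hl.1.
have [D [dD lD sleD]] : exists D, [/\ Delta D, forall k, l k <= D &
    forall x, x \in s -> x.2 <= D].
  pose D := Num.max (\big[Num.max/D0]_(k | k != 1%g) l k) (\big[Num.max/D0]_(x <- s) x.2).
  have maxD x y : Delta x -> Delta y -> Delta (Num.max x y) by case: leP.
  have dD : Delta D.
    apply: (maxD _ _); first by apply: (big_ind Delta) => // k; exact: hl.2.
    by rewrite big_seq; apply: (big_ind Delta) => //; exact: maxD.
  exists D; split => // [k|x xs].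
    have [->|k1] := eqVneq k 1%g; first by rewrite l1 ltW// hD.1.
    by rewrite /D (bigD1 k)//= !le_max lexx.
  rewrite /D le_max; apply/orP; right; elim: s xs {sD str D dD} => // y s' IH.
  by rewrite inE big_cons => /predU1P[->|/IH h]; rewrite le_max ?lexx// h orbT.
have strl x y : x \in s -> y \in s ->
    l (x.1.1^-1 * y.1.1)%g <= x.2 + l (x.1.2^-1 * y.1.2)%g + y.2.
  by move=> xs ys; have := str _ _ xs ys; rewrite ler_distl => /andP[]; lra.
have strr x y : x \in s -> y \in s ->
    l (x.1.2^-1 * y.1.2)%g <= x.2 + l (x.1.1^-1 * y.1.1)%g + y.2.
  by move=> xs ys; have := str _ _ xs ys; rewrite ler_distl => /andP[]; lra.
have sDD x : x \in s -> Delta x.2 /\ x.2 <= D by move=> xs; split; auto.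
have [K' [phi [t [l' [phiM l'D l'E l't]]]]] :=
  table_extension_capped hD hl dD lD sDD strl strr.
exists K', phi, t, l'; split => // x xs; rewrite l't; split.
  have := table_dist_le l D x.1.1 x.1.2 xs.
  by rewrite /via !mulVg l1 add0r addr0.
move=> h; apply/eqP; rewrite eq_le; apply/andP; split.
  have := table_dist_le l D x.1.1 x.1.2 xs.
  by rewrite /via !mulVg l1 add0r addr0.
by apply: table_dist_ge => //; exact: sleD.
Qed.

(** * Concentration in powers of a finite group *)

Section power.
Variable R : realType.

(** Both sides are [2 * #|T| ^ 2] times the variance of [F] under the uniform measure. *)
Lemma sum_sqr_dist (T : finType) (F : T -> R) :
  \sum_x \sum_y (F x - F y) ^+ 2 =
  2 * (#|T|%:R * \sum_x F x ^+ 2 - (\sum_x F x) ^+ 2).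
Proof.
transitivity (\sum_x (#|T|%:R * F x ^+ 2 - 2 * (F x * \sum_y F y) + \sum_y F y ^+ 2)).
  apply: eq_bigr => x _.
  have -> : #|T|%:R * F x ^+ 2 = \sum_(y : T) F x ^+ 2.
    by rewrite sumr_const mulr_natl.
  by rewrite !mulr_sumr -sumrN -!big_split/=; apply: eq_bigr => y _; ring.
rewrite !big_split/= sumrN -!mulr_sumr -mulr_suml sumr_const -mulr_natl.
by rewrite -[#|predT|]/#|T|; ring.
Qed.

Lemma sum_sqr_dist_le (T : finType) (F : T -> R) (c : R) :
  (forall x y, F x - F y <= c) ->
  \sum_x \sum_y (F x - F y) ^+ 2 <= c ^+ 2 * #|T|%:R ^+ 2.
Proof.
move=> h; have : \sum_(x : T) \sum_(y : T) c ^+ 2 = c ^+ 2 * #|T|%:R ^+ 2.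
  by rewrite !sumr_const -mulrnA -[LHS]mulr_natr natrM -expr2.
move=> <-; apply: ler_sum => x _; apply: ler_sum => y _.
have h1 := h x y; have h2 := h y x.
by rewrite -[leLHS]real_normK ?num_real// lerXn2r ?nnegrE// ?ler_norml; lra.
Qed.

(** Every 1-Lipschitz function has variance at most [c / 2]. The distance is right-invariant, to
    match the sets [V A] of the Lévy property. *)
Definition concentrated (P : finGroupType) (h : P -> R) (c : R) :=
  forall F : P -> R, (forall x y, F x - F y <= h (x * y^-1)%g) ->
    \sum_x \sum_y (F x - F y) ^+ 2 <= c * #|P|%:R ^+ 2.

(** The distance to [A] is 1-Lipschitz, vanishes on [A] and is at least [e] on [B]. The pairs in
    [A x B] and those in [B x A] both contribute, whence the factor 2. *)
Lemma concentratedP (P : finGroupType) (h : P -> R) (c e : R) (A B : {set P}) :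
  length_function h -> concentrated h c -> 0 <= e ->
  (forall a b, a \in A -> b \in B -> e <= h (b * a^-1)%g) ->
  2 * (#|A|%:R * #|B|%:R * e ^+ 2) <= c * #|P|%:R ^+ 2.
Proof.
move=> hl hc e0 hAB.
have [->|[a0 a0A]] := set_0Vmem A.
  rewrite cards0 !mul0r mulr0; apply: le_trans (hc (fun=> 0) _).
    by apply: sumr_ge0 => x _; apply: sumr_ge0 => y _; exact: sqr_ge0.
  by move=> x y; rewrite subrr length_ge0.
pose F x := \big[Num.min/h (x * a0^-1)%g]_(a in A) h (x * a^-1)%g.
have Fge x d : (forall a, a \in A -> d <= h (x * a^-1)%g) -> d <= F x.
  move=> H; apply: (big_ind (fun y => d <= y)); [exact: H| |exact: H].
  by move=> u v du dv; rewrite le_min du.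
have Fle x a : a \in A -> F x <= h (x * a^-1)%g.
  by move=> aA; rewrite /F (bigD1 a)//= ge_min lexx.
apply: le_trans (hc F _); last first.
  move=> x y; rewrite lerBlDr -lerBlDl; apply: Fge => a aA.
  rewrite lerBlDl (le_trans (Fle x a aA))//.
  by have [_ _ /(_ (x * y^-1) (y * a^-1))%g] := hl; rewrite mulgA mulgKV.
have FA a : a \in A -> F a = 0.
  move=> aA; apply/eqP; rewrite eq_le Fge ?andbT => [|b _]; last exact: length_ge0.
  by rewrite (le_trans (Fle a a aA))// mulgV; case: hl => ->.
have FB b : b \in B -> e <= F b by move=> bB; apply: Fge => a aA; exact: hAB.
have sq x y : 0 <= (F x - F y) ^+ 2 by exact: sqr_ge0.
(* For positive [e] the sets [A] and [B] are disjoint, so the two families of pairs are counted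
   separately. *)
have [e0'|e_gt0] := eqVneq e 0.
  rewrite e0' expr2 !mulr0; apply: sumr_ge0 => x _; exact: sumr_ge0.
have dAB : fintype.disjoint (mem A) (mem B).
  apply/pred0P => x /=; apply/negP => /andP[xA xB].
  by have := FB _ xB; rewrite (FA _ xA) => ?; move/negP: e_gt0; apply; rewrite eq_le e0 andbT.
have sumC (X Y : {set P}) : (forall x y, x \in X -> y \in Y -> e ^+ 2 <= (F x - F y) ^+ 2) ->
    #|X|%:R * #|Y|%:R * e ^+ 2 <= \sum_(x in X) \sum_y (F x - F y) ^+ 2.
  move=> H; rewrite -mulrA mulr_natl -sumr_const; apply: ler_sum => x xX.
  rewrite mulr_natl -sumr_const [leRHS](bigID [in Y])/= ler_wpDr ?sumr_ge0//.
  by apply: ler_sum => y yY; exact: H.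
have hA : #|A|%:R * #|B|%:R * e ^+ 2 <= \sum_(x in A) \sum_y (F x - F y) ^+ 2.
  apply: sumC => x y xA yB.
  by rewrite FA// sub0r sqrrN lerXn2r ?nnegrE ?FB// (le_trans e0 (FB _ yB)).
have hB : #|B|%:R * #|A|%:R * e ^+ 2 <= \sum_(x in B) \sum_y (F x - F y) ^+ 2.
  apply: sumC => x y xB yA.
  by rewrite (FA y)// subr0 lerXn2r ?nnegrE ?FB// (le_trans e0 (FB _ xB)).
rewrite [leRHS](bigID [in A])/=.
rewrite (le_trans (y := \sum_(x in A) \sum_y (F x - F y) ^+ 2 +
                        \sum_(x in B) \sum_y (F x - F y) ^+ 2))//.
  by move: hB; rewrite [_%:R * _%:R]mulrC; lra.
rewrite lerD2l [leRHS](bigID [in B])/= ler_wpDr//.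
  by apply: sumr_ge0 => x _; exact: sumr_ge0.
rewrite le_eqVlt; apply/orP; left; apply/eqP; apply: eq_bigl => x.
by case xB: (x \in B); rewrite ?andbF// andbT (disjointFl dAB).
Qed.

(* Efron-Stein: the variance of F on a product is the mean of the variances
   in the first coordinate plus the variance of the average over it. *)
Lemma concentrated_prod (K P : finGroupType) (h : P -> R) (c : R) : h 1%g = 0 ->
  concentrated h c ->
  concentrated (fun x : K * P => (x.1 != 1%g)%:R + h x.2) (1 + c).
Proof.
move=> h1 hc F hF.
pose S p := \sum_(k : K) F (k, p).
have K0 : 0 < #|K|%:R :> R by rewrite ltr0n; apply/card_gt0P; exists 1%g.
(* The average over the first coordinate is 1-Lipschitz for [h]. *)
have hS := hc (fun p => S p / #|K|%:R).
have {}hS : \sum_p \sum_p' (S p - S p') ^+ 2 <= c * #|P|%:R ^+ 2 * #|K|%:R ^+ 2.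
  have -> : \sum_p \sum_p' (S p - S p') ^+ 2 =
    (\sum_p \sum_p' (S p / #|K|%:R - S p' / #|K|%:R) ^+ 2) * #|K|%:R ^+ 2.
    rewrite mulr_suml; apply: eq_bigr => p _; rewrite mulr_suml.
    by apply: eq_bigr => p' _; rewrite -mulrBl expr_div_n divfK// expf_neq0// gt_eqF.
  rewrite ler_wpM2r ?exprn_ge0// ?(ltW K0)//; apply: hS => x y.
  rewrite -mulrBl ler_pdivrMr// /S -sumrB.
  have -> : h (x * y^-1)%g * #|K|%:R = \sum_(k : K) h (x * y^-1)%g.
    by rewrite sumr_const mulr_natr.
  apply: ler_sum => k _; have := hF (k, x) (k, y).
  by rewrite /= mulgV eqxx add0r.
(* On a fibre over [p], the Hamming term lets [F] vary by at most 1. *)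
have hK p : \sum_k \sum_k' (F (k, p) - F (k', p)) ^+ 2 <= #|K|%:R ^+ 2.
  have := @sum_sqr_dist_le K (fun k => F (k, p)) 1.
  rewrite expr1n mul1r; apply => k k'.
  have := hF (k, p) (k', p); rewrite /= mulgV h1 addr0 => /le_trans; apply.
  by case: (_ != _).
move: hS; rewrite !sum_sqr_dist => hS.
have {}hK : \sum_p (2 * (#|K|%:R * (\sum_k F (k, p) ^+ 2) - S p ^+ 2)) <=
    #|P|%:R * #|K|%:R ^+ 2.
  have -> : #|P|%:R * #|K|%:R ^+ 2 = \sum_(p : P) (#|K|%:R : R) ^+ 2.
    by rewrite sumr_const mulr_natl.
  apply: ler_sum => p _.
  by have := hK p; rewrite sum_sqr_dist.
move: hK; rewrite -mulr_sumr big_split/= sumrN -mulr_sumr => hK.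
rewrite card_prod natrM.
have -> : \sum_x F x = \sum_p S p.
  by rewrite exchange_big pair_big/=; apply: eq_bigr => -[].
have -> : \sum_x F x ^+ 2 = \sum_p \sum_k F (k, p) ^+ 2.
  by rewrite exchange_big pair_big/=; apply: eq_bigr => -[].
move: hS hK; set m := #|K|%:R; set N := #|P|%:R.
set a := \sum_p \sum_k _; set b := \sum_p _ ^+ 2; set d := (\sum_p _) ^+ 2.
have N0 : 0 <= N by exact: ler0n.
(* The claim is [N] times the fibre bound plus the bound on the averages. *)
move=> hS hK; have := ler_wpM2l N0 hK.
nra.
Qed.

(** [P] is a power of [K], [Q] the sum of the coordinate lengths and [h] the Hamming length. The
    induction starts from one copy of [K] on which [Q] and [h] vanish. *)
Lemma power_exists (K : finGroupType) (l : K -> R) (D : R) (n : nat) :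
  length_function l -> (forall k, l k <= D) ->
  exists (P : finGroupType) (diag : K -> P) (Q h : P -> R),
  [/\ {morph diag : x y / (x * y)%g}, length_function Q /\ length_function h,
      (forall k, Q (diag k) = l k *+ n) /\ (forall p, Q p <= D *+ n),
      forall p, Q p <= D * h p
    & (forall p z, h (z^-1 * p * z)%g = h p) /\ concentrated h n%:R].
Proof.
move=> hl lD; have [l1 lV lM] := hl.
have D0 : 0 <= D by rewrite -l1.
elim: n => [|n [P [diag [Q [h [dM [hQ hh] [Qd QD] QDh [hJ hc]]]]]]].
  exists K, id, (fun=> 0), (fun=> 0); split => //.
  - by move=> p; rewrite mulr0.
  - split=> // F hF; have := @sum_sqr_dist_le K F 0; rewrite expr0n; exact.
have [Q1 QV QM] := hQ; have [h1 hV hM] := hh.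
exists (K * P)%type, (fun k => (k, diag k)), (fun x => l x.1 + Q x.2),
  (fun x => (x.1 != 1%g)%:R + h x.2); split.
- by move=> x y; rewrite dM.
- split; split => /=.
  + by rewrite l1 Q1 addr0.
  + by move=> x; rewrite lV QV.
  + move=> x y; have := lM x.1 y.1; have := QM x.2 y.2; lra.
  + by rewrite eqxx h1 addr0.
  + by move=> x; rewrite hV -(inj_eq invg_inj) invgK invg1.
  + move=> x y; rewrite [leRHS]addrACA lerD ?hM//.
    change (((x.1 * y.1)%g != 1%g)%:R <= (x.1 != 1%g)%:R + (y.1 != 1%g)%:R :> R).
    have [->|x1] := eqVneq x.1 1%g; first by rewrite mul1g add0r.
    by rewrite (le_trans (y := 1)) ?lerDl//; case: (_ != _).
- split; first by move=> k; rewrite /= Qd mulrS.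
  by move=> p; rewrite mulrS lerD.
- move=> p; rewrite mulrDr lerD//.
  by have [->|p1] := eqVneq p.1 1%g; rewrite ?l1 ?mulr0// mulr1.
- split; last by rewrite mulrS; exact: concentrated_prod.
  move=> p z /=; rewrite hJ; congr (_%:R + _); congr (~~ _).
  change ((z.1^-1 * p.1 * z.1 == 1)%g = (p.1 == 1%g)).
  apply/eqP/eqP => [zp|->]; last by rewrite mulg1 mulVg.
  by apply: (mulgI z.1^-1%g); apply: (mulIg z.1); rewrite mulg1 mulVg.
Qed.

(** The Hamming length is invariant under conjugation and, times [D / n], dominates the averaged
    length. So an element of small Hamming length has all its conjugates short, and Hamming
    concentration applies. *)
Lemma power_extension (Delta : set R) (K : finGroupType) (l : K -> R)
    (delta : R) (M : nat) :
  capped_sum_closed Delta -> length_in Delta l -> Delta delta ->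
  exists (K' : finGroupType) (phi : K -> K') (l' : K' -> R),
  [/\ {morph phi : x y / (x * y)%g}, length_in Delta l',
      forall k, l' (phi k) = l k
    & forall A B : {set K'},
        (forall a b, a \in A -> b \in B ->
          ~ forall x, l' ((phi x)^-1 * (b * a^-1) * phi x)%g <= delta) ->
        (M * (#|A| * #|B|) <= #|K'| ^ 2)%N].
Proof.
move=> hD hl dd; have [[l1 lV lM] lD] := hl.
pose D := \big[Num.max/delta]_(k | k != 1%g) l k.
have d0 : 0 < delta by exact: hD.1.
have dD : Delta D.
  by apply: (big_ind Delta) => // x y; case: leP.
have deltaD : delta <= D.
  apply: (big_rec (fun y => delta <= y)) => // x y _ dy.
  by rewrite le_max dy orbT.
have D0 : 0 < D by exact: hD.1.
have lleD k : l k <= D.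
  have [->|k1] := eqVneq k 1%g; first by rewrite l1 ltW.
  by rewrite /D (bigD1 k)//= le_max lexx.
pose n := (Num.bound (M%:R * D ^+ 2 / delta ^+ 2)).+1.
have n0 : 0 < n%:R :> R by rewrite ltr0n.
have hn : M%:R * D ^+ 2 <= n%:R * delta ^+ 2.
  have /archi_boundP : 0 <= M%:R * D ^+ 2 / delta ^+ 2.
    by rewrite divr_ge0 ?sqr_ge0// mulr_ge0 ?sqr_ge0.
  rewrite ltr_pdivrMr ?exprn_gt0// => /ltW/le_trans; apply.
  by rewrite ler_pM2r ?exprn_gt0// ler_nat.
have [P [diag [Q [h [dM [hQ hh] [Qd QD] QDh [hJ hc]]]]]] := power_exists n hl.1 lleD.
have hq : length_function (fun p => Q p / n%:R).
  have [Q1 QV QM] := hQ; split=> [|x|x y]; first by rewrite Q1 mul0r.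
    by rewrite QV.
  by rewrite -mulrDl ler_pM2r// invr_gt0.
have qD p : Q p / n%:R <= D by rewrite ler_pdivrMr// mulr_natr.
(* With [delta] in [V], lengths at most [delta] stay so after rounding. *)
pose V := delta :: [seq l k | k <- enum K & k != 1%g].
have hV v : v \in V -> Delta v /\ v <= D.
  rewrite inE => /predU1P[->//|/mapP[k]].
  by rewrite mem_filter => /andP[k1 _] -> ; split => //; exact: lD.
have [l' [l'D l'E l'le]] := round_length hD hq dD qD hV.
exists P, diag, l'; split=> // [k|A B hAB].
  have [->|k1] := eqVneq k 1%g.
    rewrite (morph_group1 dM).
    by case: l'D => -[-> _ _] _.
  have qk : Q (diag k) / n%:R = l k by rewrite Qd -[l k *+ n]mulr_natr mulfK// gt_eqF.
  rewrite l'E qk// inE; apply/orP; right; apply/mapP; exists k => //.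
  by rewrite mem_filter k1 mem_enum.
(* Hamming length below [e] forces averaged length below [delta]. At this threshold the product of
   the densities is at most [D ^ 2 / (2 * n * delta ^ 2)], which explains the choice of [n]. *)
pose e := delta * n%:R / D.
have e0 : 0 <= e by rewrite divr_ge0 ?mulr_ge0// ltW.
have hABe a b : a \in A -> b \in B -> e <= h (b * a^-1)%g.
  move=> aA bB; rewrite leNgt; apply/negP => he; apply: (hAB _ _ aA bB) => x.
  apply: l'le; first by rewrite inE eqxx.
  rewrite ler_pdivrMr// (le_trans (QDh _))// hJ.
  by rewrite mulrC -ler_pdivlMr// ltW.
have := concentratedP hh hc e0 hABe.
rewrite -(ler_nat R) natrM natrX natrM.
set x := #|A|%:R * #|B|%:R; set N := #|P|%:R; move=> h1.
have x0 : 0 <= x by rewrite mulr_ge0.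
have h2 : x * (n%:R * delta ^+ 2) <= N ^+ 2 * D ^+ 2.
  have -> : x * (n%:R * delta ^+ 2) = x * e ^+ 2 * D ^+ 2 / n%:R.
    by rewrite /e; field; rewrite !gt_eqF.
  rewrite ler_pdivrMr// [leRHS]mulrAC ler_pM2r ?exprn_gt0// [leRHS]mulrC.
  have := mulr_ge0 x0 (sqr_ge0 e); lra.
rewrite -(ler_pM2r (exprn_gt0 2 D0)); apply: le_trans h2.
by rewrite mulrAC [leLHS]mulrC ler_wpM2l.
Qed.

End power.

(** * Lévy sequences of finite subgroups *)

Section uniform_image.
Variables (R : realType) (G : topologicalGroupType) (F : finGroupType).
Variable alpha : F -> G.

Lemma uniform_weight_ge0 : 0 <= #|F|%:R^-1 :> R.
Proof. by rewrite invr_ge0. Qed.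

Definition uniform_weight : {nonneg R} := NngNum uniform_weight_ge0.

(** The push-forward of the uniform measure on [F], written as a scaled sum of point masses to
    inherit a measure structure. *)
Definition uniform_image : set (borel G) -> \bar R :=
  mscale uniform_weight
    (msum (fun k => dirac (alpha (nth 1%g (enum F) k) : borel G)) #|F|).

HB.instance Definition _ := Measure.on uniform_image.

Lemma uniform_imageE (A : set G) :
  uniform_image A = (#|[pred x | alpha x \in A]|%:R / #|F|%:R)%:E.
Proof.
rewrite /uniform_image /mscale /= mulrC EFinM; congr (_ * _)%E; rewrite /msum /=.
under eq_bigr do rewrite diracE.
rewrite sumEFin -natr_sum; congr ((_%:R)%:E).
transitivity (\sum_(x <- enum F) (alpha x \in A))%N.
  by rewrite (big_nth 1%g) -cardE big_mkord.
rewrite big_enum /= -sum1_card [RHS]big_mkcond /=.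
by apply: eq_bigr => x _; rewrite inE; case: (_ \in A).
Qed.

Lemma uniform_image_setT : uniform_image setT = 1%E.
Proof.
rewrite uniform_imageE (eq_card (B := F)) ?divff// => [|x].
  by rewrite pnatr_eq0 -lt0n; apply/card_gt0P; exists 1%g.
by rewrite !inE; exact: mem_set.
Qed.

HB.instance Definition _ :=
  Measure_isProbability.Build _ _ _ uniform_image uniform_image_setT.

Definition uniform_probability : probability (borel G) R := uniform_image.

Hypothesis alpha_inj : injective alpha.
Hypothesis alphaM : {morph alpha : x y / (x * y)%g}.

Lemma finite_range_alpha : finite_set (range alpha).
Proof. exact: finite_image. Qed.

Lemma subgroup_range : subgroup (range alpha).
Proof.
split; first by rewrite inE; exists 1%g => //; exact: morph_group1.
move=> x y; rewrite !inE => -[a _ <-] [b _ <-].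
by exists (a * b^-1)%g => //; rewrite alphaM (morph_groupV alphaM).
Qed.

Lemma card_fset_set_range (A : set G) :
  #|` fset_set (A `&` range alpha)| = #|[pred x | alpha x \in A]|.
Proof.
have -> : A `&` range alpha = [set` [fset alpha x | x in [pred x | alpha x \in A]]%fset].
  apply/seteqP; split => y /=.
    by move=> [Ay [x _ xy]]; apply/imfsetP; exists x => //=; apply: mem_set; rewrite xy.
  by move=> /imfsetP[x /= /set_mem Ax ->]; split => //; exists x.
by rewrite set_fsetK card_imfset//= cardE.
Qed.

Lemma uniform_normalized_counting :
  normalized_counting (range alpha) uniform_probability.
Proof.
move=> A _; rewrite -[LHS]/(uniform_image A) uniform_imageE.
rewrite card_fset_set_range -[X in fset_set X]setTI card_fset_set_range.
congr ((_ / _%:R)%:E); apply: eq_card => x; rewrite !inE.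
by apply/esym/mem_set.
Qed.

(** Invariance is a change of variables in [F]. For regularity, [A] meets the range in a finite,
    hence compact, set of the same measure. *)
Lemma uniform_normalized_haar :
  normalized_haar (range alpha) uniform_probability.
Proof.
have E A : uniform_probability A = uniform_image A by [].
split.
- rewrite E uniform_imageE (eq_card (B := F)) ?divff// => [|x].
    by rewrite pnatr_eq0 -lt0n; apply/card_gt0P; exists 1%g.
  by rewrite !inE; apply: mem_set; exists x.
- move=> _ A [k _ <-] _; rewrite !E !uniform_imageE; congr ((_%:R / _)%:E).
  rewrite -[RHS](fintype.card_image (mulgI k)); apply: eq_card => x.
  rewrite [LHS]inE; apply/idP/fintype.imageP => [|[y]].
    move=> /set_mem[a Aa kax]; exists (k^-1 * x)%g; last by rewrite mulKVg.
    by rewrite inE alphaM (morph_groupV alphaM) -kax mulKg.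
  move=> Ay ->; rewrite inE in Ay; apply: mem_set.
  by exists (alpha y) => //; rewrite alphaM.
move=> A mA; rewrite !E; apply/eqP; rewrite eq_le; apply/andP; split.
  apply: ereal_sup_ubound; exists (A `&` range alpha).
    by split; [exact/finite_compact/finite_setIr/finite_range_alpha|exact: subIsetl].
  rewrite !E !uniform_imageE; congr ((_%:R / _)%:E); apply: eq_card => x.
  rewrite !inE; apply/idP/idP => /set_mem; first by case=> Ax _; exact: mem_set.
  by move=> Ax; apply: mem_set; split => //; exists x.
apply: ge_ereal_sup => _ [C [_ CA] <-]; rewrite !E !uniform_imageE lee_fin.
rewrite ler_wpM2r ?invr_ge0// ler_nat; apply: subset_leq_card.
by apply/fintype.subsetP => x; rewrite !inE; exact: CA.
Qed.

End uniform_image.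

(** * A combinatorial criterion for Lévy sequences *)

Section levy_criterion.
Variables (R : realType) (G : topologicalGroupType) (F : nat -> finGroupType).
Variable alpha : forall i, F i -> G.
Hypothesis alpha_inj : forall i, injective (@alpha i).
Hypothesis alphaM : forall i, {morph @alpha i : x y / (x * y)%g}.
Hypothesis alpha_incr : forall i, range (@alpha i) `<=` range (@alpha i.+1).
Hypothesis alpha_dense : dense (\bigcup_i range (@alpha i)).
Hypothesis alpha_conc : forall (V : set G) (M : nat), open V -> V 1%g ->
  \forall i \near \oo, forall A B : {set F i},
    (forall a b, a \in A -> b \in B -> ~ V (alpha (b * a^-1)%g)) ->
    (M * (#|A| * #|B|) <= #|F i| ^ 2)%N.

Lemma limn_einf_gt0 (u : (\bar R)^nat) : (0 < limn_einf u)%E ->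
  exists2 c : R, 0 < c & \forall i \near \oo, (c%:E <= u i)%E.
Proof.
rewrite limn_einf_lim (cvg_lim _ (@cvg_einfs_sup _ u))// => /ereal_sup_gt[_ [n _ <-]].
rewrite /einfs/= => h.
have [c c0 hc] : exists2 c : R, 0 < c & (c%:E <= ereal_inf (sdrop u n))%E.
  case: (ereal_inf _) h => [r|_|//]; last by exists 1; rewrite ?leey.
  by rewrite lte_fin => r0; exists r.
exists c => //; exists n => // i /= ni.
by apply: (le_trans hc); apply: ereal_inf_lbound; exists i.
Qed.

(** The concentration bound is applied to [A i] and the complement of [V A i]: the former has
    density bounded below, so the latter has small density. *)
Lemma concentration_levy_sequence :
  levy_sequence (fun i => range (@alpha i))
    (fun i => uniform_probability R (@alpha i)).
Proof.
split => //.
  move=> i; split; first exact: subgroup_range.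
  exact/finite_compact/finite_range_alpha.
move=> V A oV V1 hA /limn_einf_gt0[c c0 hc].
pose VA i := [set (v * a)%g | v in V & a in A i].
pose r := fun i : nat => #|[pred x | @alpha i x \in VA i]|%:R / #|F i|%:R : R.
have F0 i : 0 < #|F i|%:R :> R by rewrite ltr0n; apply/card_gt0P; exists 1%g.
have rE : (fun i => uniform_probability R (@alpha i) (VA i)) = EFin \o r.
  apply/funext => i.
  by rewrite -[LHS]/(uniform_image R (@alpha i) (VA i)) uniform_imageE.
suff : EFin \o r @ \oo --> 1%E by rewrite -rE.
apply/cvg_EFin; first by exists 0%N.
apply/cvgrPdist_le => /= e e0.
(* If [A i] has density at least [c], the complement has density at most [1 / (M * c)], hence at
   most [e]. *)
pose M := (Num.bound (c * e)^-1).+1.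
have ce0 : 0 < c * e by exact: mulr_gt0.
near=> i.
have hci : c <= #|[pred x | @alpha i x \in A i]|%:R / #|F i|%:R.
  have : (c%:E <= uniform_image R (@alpha i) (A i))%E by near: i.
  by rewrite uniform_imageE lee_fin.
have hMi : forall A B : {set F i},
    (forall a b, a \in A -> b \in B -> ~ V (alpha (b * a^-1)%g)) ->
    (M * (#|A| * #|B|) <= #|F i| ^ 2)%N by near: i; exact: alpha_conc.
pose A' := [set x : F i | @alpha i x \in A i]%SET.
pose B' := [set x : F i | @alpha i x \notin VA i]%SET.
have : (M * (#|A'| * #|B'|) <= #|F i| ^ 2)%N.
  apply: hMi => a b.
  rewrite !inE => aA bB Vba; move/negP: bB; apply; rewrite inE.
  exists (alpha (b * a^-1)%g) => //; exists (alpha a) => //.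
  by rewrite -alphaM mulgKV.
have cB : #|B'|%:R = #|F i|%:R - #|[pred x | @alpha i x \in VA i]|%:R :> R.
  rewrite -(cardC [pred x | @alpha i x \in VA i]) natrD addrAC subrr add0r.
  by congr (_%:R); apply: eq_card => x; rewrite !inE.
have cA : #|A'| = #|[pred x | @alpha i x \in A i]| by rewrite cardsE.
rewrite -(ler_nat R) natrM natrX natrM cA cB.
move: hci; rewrite /r; set a := #|[pred x | @alpha i x \in A i]|%:R;
  set b := #|[pred x | @alpha i x \in VA i]|%:R; set N := #|F i|%:R.
have N0 : 0 < N by exact: F0.
have bN : b <= N by rewrite ler_nat max_card.
rewrite ler_pdivlMr// => caN hM.
have -> : 1 - b / N = (N - b) / N by rewrite mulrBl divff// gt_eqF.
rewrite ger0_norm ?divr_ge0 ?subr_ge0// ?(ltW N0)// ler_pdivrMr//.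
have hMe : 1 <= M%:R * (c * e).
  rewrite -ler_pdivrMr// div1r.
  have := archi_boundP (ltW (_ : 0 < (c * e)^-1)); rewrite invr_gt0 => /(_ ce0)/ltW/le_trans; apply.
  by rewrite ler_nat.
have h1 : M%:R * (c * N * (N - b)) <= N ^+ 2.
  apply: le_trans hM; rewrite ler_wpM2l// ler_wpM2r// subr_ge0//.
have Nb : 0 <= N - b by rewrite subr_ge0.
rewrite -(ler_pM2l N0) -(ler_pM2l c0).
have h2 : (N - b) * N <= M%:R * (c * e) * ((N - b) * N).
  by rewrite ler_peMl ?mulr_ge0// ltW.
have h3 := ler_wpM2r (ltW e0) h1.
rewrite ler_pM2l//; move: h2 h3; nra.
Unshelve. all: by end_near.
Qed.

End levy_criterion.

Import metricType_numDomainType.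

(** * Neighborhoods of isometries and metrics from lengths *)

Section isometry_neighborhoods.
Variables (R : realType) (X : metricType R).

(** The basic sets around [g] generate a filter converging pointwise to [g], so each open set
    containing [g] belongs to it. *)
Lemma isometry_basic_nbhs (V : set (isometry_group X)) (g : isometry_group X) :
  open V -> V g -> exists (s : seq X) (eps : R), 0 < eps /\
    forall h : isometry_group X,
      (forall x, x \in s -> mdist (g x) (h x) < eps) -> V h.
Proof.
move=> [B oB <-] Bg.
pose basic (s : seq X) (eps : R) := [set h : isometry_group X |
  forall x, x \in s -> mdist (g x) (h x) < eps].
pose F : set_system (isometry_group X) :=
  [set A | exists (s : seq X) (eps : R), 0 < eps /\ basic s eps `<=` A].
have FF : Filter F.
  split.
  - by exists [::], 1; split.
  - move=> P Q [s [e [e0 sP]]] [t [d [d0 tQ]]].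
    exists (s ++ t), (Num.min e d); split; first by rewrite lt_min e0.
    move=> h hst; split; [apply: sP|apply: tQ] => x xs;
      have := hst x; rewrite mem_cat xs ?orbT => /(_ isT); rewrite lt_min => /andP[] //.
  - move=> P Q PQ [s [e [e0 sP]]]; exists s, e; split => //.
    exact: subset_trans PQ.
have cF : {ptws, (isometry_fun (M := X)) @ F --> (g : X -> X)}.
  apply/pointwise_cvgP => x; apply/cvgrPdist_lt => e e0.
  by exists [:: x], e; split => // h; apply; rewrite inE.
have : nbhs (isometry_fun g : {ptws X -> X}) B by exact: open_nbhs_nbhs.
by move=> /cF[s [e [e0 sB]]]; exists s, e; split => // h /sB.
Qed.

End isometry_neighborhoods.

Section length_space.
Variables (R : realType) (G : groupType) (l : G -> R).
Hypothesis length_l : length_function l.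
Hypothesis l_eq1 : forall x, l x = 0 -> x = 1%g.

(** The type takes both proofs as arguments, so that a metric instance can be attached to it. *)
Definition length_space of length_function l & (forall x, l x = 0 -> x = 1%g) :
  Type := G.

Local Notation S := (length_space length_l l_eq1).

Definition length_dist (x y : S) : R := l ((x : G)^-1 * y)%g.

Lemma length_distxx x : length_dist x x = 0.
Proof. by rewrite /length_dist mulVg; case: length_l. Qed.

Lemma length_dist_eq0 x y : length_dist x y = 0 -> x = y.
Proof.
by move=> /l_eq1 xy; apply: (mulgI (x : G)^-1%g); rewrite xy mulVg.
Qed.

Lemma length_distC x y : length_dist x y = length_dist y x.
Proof. exact: length_dist_sym. Qed.

Lemma length_distD y x z : length_dist x z <= length_dist x y + length_dist y z.
Proof. exact: length_dist_triangle. Qed.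

HB.instance Definition _ := Choice.on S.
HB.instance Definition _ := isMetric.Build R S length_distxx length_dist_eq0
  length_distC length_distD.

Definition length_metric : metricType R := S.

End length_space.

(** * Chains of finite groups acting on a metric space *)

Section chain.
Variables (R : realType) (X : metricType R) (F : nat -> finGroupType).
Variables (l : forall i, F i -> R) (e : forall i, F i -> X).
Variable phi : forall i, F i -> F i.+1.
Hypothesis l_eq1 : forall i x, @l i x = 0 -> x = 1%g.
Hypothesis eE : forall i (x y : F i), mdist (e x) (e y) = l (x^-1 * y)%g.
Hypothesis phiM : forall i, {morph @phi i : x y / (x * y)%g}.
Hypothesis e_phi : forall i (x : F i), e (phi x) = e x.
Hypothesis e_onto : forall u, exists i, exists x : F i, e x = u.

Lemma chain_inj i : injective (@e i).
Proof.
move=> x y xy; apply: (mulgI x^-1%g); rewrite mulVg; symmetry; apply: l_eq1.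
by rewrite -eE xy mdistxx.
Qed.

Lemma chain_trans i j : (i <= j)%N ->
  exists2 psi : F i -> F j, {morph psi : x y / (x * y)%g} & forall x, e (psi x) = e x.
Proof.
elim: j => [|j IH]; first by rewrite leqn0 => /eqP ->; exists id.
rewrite leq_eqVlt => /predU1P[->|]; first by exists id.
rewrite ltnS => /IH[psi psiM psiE]; exists (@phi j \o psi) => [x y|x] /=.
  by rewrite psiM phiM.
by rewrite e_phi psiE.
Qed.

Lemma chain_level (s : seq X) : exists i0, forall i, (i0 <= i)%N ->
  forall u, u \in s -> exists x : F i, e x = u.
Proof.
elim: s => [|u s [i0 IH]]; first by exists 0%N.
have [j [x xu]] := e_onto u; exists (maxn i0 j) => i.
rewrite geq_max => /andP[i0i ji] v; rewrite inE => /predU1P[->|]; last exact: IH.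
by have [psi _ psiE] := chain_trans ji; exists (psi x); rewrite psiE.
Qed.

(** Any stage containing both factors computes their product; the stages agree because the
    transition maps are morphisms over [X]. *)
Lemma chain_mul : exists mul : X -> X -> X,
  forall i (x y : F i), mul (e x) (e y) = e (x * y)%g.
Proof.
suff /choice[m mE] : forall p : X * X, exists w, forall i (x y : F i),
    e x = p.1 -> e y = p.2 -> e (x * y)%g = w.
  by exists (fun u v => m (u, v)) => i x y; rewrite (mE (e x, e y) i x y).
move=> [u v]; have [i0 /(_ _ (leqnn i0)) h] := chain_level [:: u; v].
have [x0 x0u] : exists x : F i0, e x = u by apply: h; rewrite inE eqxx.
have [y0 y0v] : exists x : F i0, e x = v by apply: h; rewrite !inE eqxx orbT.
exists (e (x0 * y0)%g) => i x y /= xu yv.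
have [psi psiM psiE] := chain_trans (leq_maxl i0 i).
have [chi chiM chiE] := chain_trans (leq_maxr i0 i).
rewrite -chiE -psiE chiM psiM; congr (e (_ * _)%g); apply: chain_inj.
  by rewrite chiE psiE xu.
by rewrite chiE psiE yv.
Qed.

Lemma chain_act (mul : X -> X -> X) :
  (forall i (x y : F i), mul (e x) (e y) = e (x * y)%g) ->
  exists alpha : forall i, F i -> isometry_group X,
    forall i (x : F i) u, alpha i x u = mul (e x) u.
Proof.
move=> mulE.
have act i (x : F i) : exists g : isometry_group X, forall u, g u = mul (e x) u.
  have lvl u v : exists j (z y y' : F j), [/\ e z = e x, e y = u & e y' = v].
    have [j0 h] := chain_level [:: u; v].
    have := h _ (leq_maxl j0 i) u; rewrite inE eqxx => /(_ isT)[y yu].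
    have := h _ (leq_maxl j0 i) v; rewrite !inE eqxx orbT => /(_ isT)[y' y'v].
    have [psi _ psiE] := chain_trans (leq_maxr j0 i).
    by exists (maxn j0 i), (psi x), y, y'; rewrite psiE.
  have iso : isometric (mul (e x)).
    move=> u v; have [j [z [y [y' [zx yu y'v]]]]] := lvl u v.
    rewrite -zx -yu -y'v !mulE !eE invgM -mulgA; congr (l (_ * _)%g).
    by rewrite mulKg.
  have /choice[h hK] : forall u, exists v, mul (e x) v = u.
    move=> u; have [j [z [y [_ [zx yu _]]]]] := lvl u u.
    by exists (e (z^-1 * y)%g); rewrite -zx -yu mulE mulKVg.
  have bij : bijective (mul (e x)).
    exists h => u; last exact: hK.
    by apply: mdist_positivity; rewrite -iso hK mdistxx.
  by exists (Isometry iso bij).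
exists (fun i x => sval (cid (act i x))) => i x u.
by case: cid => g /= ->.
Qed.

Hypothesis l_conc : forall i (A B : {set F i.+1}),
  (forall a b, a \in A -> b \in B ->
    ~ forall x : F i, l ((phi x)^-1 * (b * a^-1) * phi x)%g <= i.+1%:R^-1) ->
  (i * (#|A| * #|B|) <= #|F i.+1| ^ 2)%N.

(** By left-invariance, [g] moves [x] by the length of [x^-1 g x]. A neighborhood constrains
    finitely many points, which lie in [F i] for large [i]; so it contains every element whose
    conjugates by [F i] are all short. *)
Lemma chain_concentration : exists alpha : forall i, F i -> isometry_group X,
  [/\ forall i, injective (@alpha i),
      forall i, {morph @alpha i : x y / (x * y)%g},
      forall i j (x : F i) (y : F j), e x = e y -> alpha i x = alpha j y,
      forall i (x y : F i), alpha i x (e y) = e (x * y)%g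
    & forall (V : set (isometry_group X)) (M : nat), open V -> V 1%g ->
        \forall i \near \oo, forall A B : {set F i},
          (forall a b, a \in A -> b \in B -> ~ V (alpha i (b * a^-1)%g)) ->
          (M * (#|A| * #|B|) <= #|F i| ^ 2)%N].
Proof.
have [mul mulE] := chain_mul; have [alpha alphaE] := chain_act mulE.
exists alpha; split.
- move=> i x y xy; apply: chain_inj.
  by rewrite -[x]mulg1 -[y]mulg1 -!mulE -!alphaE xy.
- move=> i x y; apply: isometry_ext => u.
  have [j0 h] := chain_level [:: u].
  have := h _ (leq_maxl j0 i) u; rewrite inE eqxx => /(_ isT)[w <-].
  have [psi psiM psiE] := chain_trans (leq_maxr j0 i).
  rewrite -[RHS]/(alpha i x (alpha i y (e w))) !alphaE -!psiE psiM !mulE.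
  by rewrite mulgA.
- by move=> i j x y xy; apply: isometry_ext => u; rewrite !alphaE xy.
- by move=> i x y; rewrite alphaE mulE.
move=> V M oV V1.
have [s [eps [eps0 sV]]] := isometry_basic_nbhs oV V1.
have [i0 hi0] := chain_level s.
(* The concentration hypothesis concerns [F i.+1], whence the successor; [M <= i] absorbs the factor
   [M]. *)
exists (maxn M (maxn i0 (Num.bound eps^-1))).+1 => // -[//|i] /=.
rewrite ltnS !geq_max => /and3P[Mi i0i bi] A B hAB.
apply: (@leq_trans (i * (#|A| * #|B|))); first by rewrite leq_mul2r Mi orbT.
apply: l_conc => a b aA bB hx; apply: (hAB a b aA bB); apply: sV => u us.
have [x <-] := hi0 _ i0i _ us.
rewrite -[isometry_fun 1%g _]/(e x) -(e_phi x) alphaE mulE eE mulgA.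
apply: le_lt_trans (hx x) _.
have epsV : 0 <= eps^-1 by rewrite invr_ge0 ltW.
rewrite invf_plt ?posrE//; apply: lt_le_trans (archi_boundP epsV) _.
by rewrite ler_nat (leq_trans bi).
Qed.

End chain.

(** * Hall's group *)

Section initial_group.
Variables (H : groupType) (T : topologicalGroupType) (lambda : H -> T).
Hypothesis lambdaM : {morph lambda : x y / (x * y)%g}.
Hypothesis lambda_inj : injective lambda.

Definition initial_group of {morph lambda : x y / (x * y)%g} &
  injective lambda : Type := H.

Local Notation W := (initial_group lambdaM lambda_inj).

HB.instance Definition _ := Group.copy W H.
HB.instance Definition _ := Topological.copy W (initial_topology lambda).

Lemma lambda_continuous : continuous (lambda : W -> T).
Proof. exact: initial_continuous. Qed.

Lemma initial_group_continuous (S : topologicalType) (h : S -> W) :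
  continuous (lambda \o h) -> continuous h.
Proof. exact: continuous_comp_initial. Qed.

Lemma initial_group_mul_continuous :
  continuous (fun x : W * W => (x.1 * x.2)%g).
Proof.
apply: initial_group_continuous => x.
have -> : lambda \o (fun x : W * W => (x.1 * x.2)%g) =
    (fun y : T * T => (y.1 * y.2)%g) \o (fun x : W * W => (lambda x.1, lambda x.2)).
  by apply/funext => y /=; rewrite lambdaM.
apply: continuous_comp; last exact: mulg_continuous.
apply: cvg_pair; [apply: (@cvg_comp _ _ _ fst lambda); [exact: cvg_fst|]|
  apply: (@cvg_comp _ _ _ snd lambda); [exact: cvg_snd|]];
  exact: lambda_continuous.
Qed.

Lemma initial_group_inv_continuous : continuous (fun x : W => x^-1%g).
Proof.
apply: initial_group_continuous => x.
have -> : lambda \o (fun x : W => x^-1%g) = (fun y : T => y^-1%g) \o (lambda : W -> T).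
  by apply/funext => y /=; rewrite (morph_groupV lambdaM).
by apply: continuous_comp; [exact: lambda_continuous|exact: invg_continuous].
Qed.

Lemma initial_group_hausdorff : hausdorff_space W.
Proof.
rewrite open_hausdorff => x y xy.
have := @topgroup_hausdorff T; rewrite open_hausdorff => /(_ (lambda x) (lambda y)).
rewrite (inj_eq lambda_inj) => /(_ xy)[[A B]/= [xA yB] [oA oB AB0]].
exists ((lambda : W -> T) @^-1` A, (lambda : W -> T) @^-1` B).
  by split; rewrite inE /=; [move: xA|move: yB]; rewrite inE.
split; [by exists A|by exists B|].
by rewrite -preimage_setI (eqP AB0) preimage_set0.
Qed.

HB.instance Definition _ := PreTopologicalGroup_isTopologicalGroup.Build W
  initial_group_mul_continuous initial_group_inv_continuous
  initial_group_hausdorff.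

Definition initial_topgroup : topologicalGroupType := W.

End initial_group.

(** Once [H] is destructed, the copied group structure is convertible to it. *)
Lemma initial_topgroupE (H : groupType) (T : topologicalGroupType)
    (lambda : H -> T) (lambdaM : {morph lambda : x y / (x * y)%g})
    (lambda_inj : injective lambda) :
  (initial_topgroup lambdaM lambda_inj : groupType) = H.
Proof. by case: H lambda lambdaM lambda_inj. Qed.

(** * Finite subgroups as finite groups *)

Section finite_subgroup.
Variables (H : groupType) (S : {fset H}).
Hypothesis S_subgroup : subgroup [set` S].

Definition finite_subgroup of subgroup [set` S] : Type := S.

Local Notation L := (finite_subgroup S_subgroup).

HB.instance Definition _ := Finite.copy L S.

Lemma finite_subgroup1 : (1%g : H) \in S.
Proof. by case: S_subgroup; rewrite inE. Qed.

Lemma finite_subgroupM (x y : L) : (val x * val y)%g \in S.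
Proof.
have [_ SB] := S_subgroup; have S1 := finite_subgroup1.
have := SB (val x) (val y)^-1%g; rewrite !inE invgK; apply => //.
  exact: valP.
have := SB 1%g (val y); rewrite !inE mul1g; apply => //; exact: valP.
Qed.

Lemma finite_subgroupV (x : L) : (val x)^-1%g \in S.
Proof.
have [_ SB] := S_subgroup; have S1 := finite_subgroup1.
have := SB 1%g (val x); rewrite !inE mul1g; apply => //; exact: valP.
Qed.

Definition finsub_mul (x y : L) : L := FSetSub (finite_subgroupM x y).
Definition finsub_one : L := FSetSub finite_subgroup1.
Definition finsub_inv (x : L) : L := FSetSub (finite_subgroupV x).

Lemma finsub_mulA : associative finsub_mul.
Proof. by move=> x y z; apply: val_inj; exact: mulgA. Qed.
Lemma finsub_mul1 : left_id finsub_one finsub_mul.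
Proof. by move=> x; apply: val_inj; exact: mul1g. Qed.
Lemma finsub_mulV : left_inverse finsub_one finsub_inv finsub_mul.
Proof. by move=> x; apply: val_inj; exact: mulVg. Qed.

HB.instance Definition _ := Finite_isGroup.Build L
  finsub_mulA finsub_mul1 finsub_mulV.

Definition finsub_group : finGroupType := L.

End finite_subgroup.

Lemma finite_subgroup_exists (H : groupType) (S : set H) :
  subgroup S -> finite_set S ->
  exists (L : finGroupType) (j : L -> H), group_embedding j /\ range j = S.
Proof.
move=> sS fS.
have sS' : subgroup [set` fset_set S] by rewrite fset_setK.
exists (finsub_group sS'), (fun x => val (x : fset_set S)); split.
  by split=> //; exact: val_inj.
apply/seteqP; split => [_ [x _ <-]|x Sx].
  by have := valP (x : fset_set S); rewrite in_fset_set// inE.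
have xS : x \in fset_set S by rewrite in_fset_set// inE.
by exists (FSetSub xS).
Qed.

(* Every new element gets the maximal length. *)
Lemma trivial_extension (R : realType) (Delta : set R) (K L : finGroupType)
    (l : K -> R) (i : K -> L) :
  capped_sum_closed Delta -> Delta !=set0 -> length_in Delta l ->
  group_embedding i ->
  exists l' : L -> R, length_in Delta l' /\ forall k, l' (i k) = l k.
Proof.
move=> hD [D0 dD0] hl [i_inj iM]; have [[l1 lV lM] lD] := hl.
pose D := \big[Num.max/D0]_(k | k != 1%g) l k.
have dD : Delta D by apply: (big_ind Delta) => // x y; case: leP.
have D_gt0 : 0 < D by exact: hD.1.
have lleD k : l k <= D.
  have [->|k1] := eqVneq k 1%g; first by rewrite l1 ltW.
  by rewrite /D (bigD1 k)//= le_max lexx.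
have i1 : i 1%g = 1%g := morph_group1 iM.
have iV k : i k^-1%g = (i k)^-1%g := morph_groupV iM k.
have l0 k : 0 <= l k by exact: length_ge0 hl.1.
pose l' y := if [pick x | i x == y] is Some x then l x else D.
have l'i k : l' (i k) = l k.
  rewrite /l'; case: pickP => [x /eqP/i_inj ->//|/(_ k)].
  by rewrite eqxx.
have l'P y : (exists2 k, y = i k & l' y = l k) \/ (l' y = D /\ forall k, y <> i k).
  rewrite /l'; case: pickP => [x /eqP <-|h]; first by left; exists x.
  by right; split => // k yk; have := h k; rewrite yk eqxx.
exists l'; split=> //; split; last first.
  move=> y y1; case: (l'P y) => [[k yk ->]|[-> _]//]; apply: lD.
  by apply: contra_neq y1 => k1; rewrite yk k1.
split; first by rewrite -i1 l'i.
  move=> y; case: (l'P y) => [[k -> ->]|[-> yN]]; first by rewrite -iV l'i lV.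
  case: (l'P y^-1%g) => [[k yk _]|[-> _]//].
  by exfalso; apply: (yN k^-1%g); rewrite iV -yk invgK.
move=> y z; case: (l'P y) => [[k yk ->]|[-> yN]]; case: (l'P z) => [[m zm ->]|[-> zN]].
- by rewrite yk zm -iM l'i.
- case: (l'P (y * z)%g) => [[n yzn _]|[-> _]]; last by rewrite lerDr.
  by exfalso; apply: (zN (k^-1 * n)%g); rewrite iM iV -yzn yk mulKg.
- case: (l'P (y * z)%g) => [[n yzn _]|[-> _]]; last by rewrite lerDl.
  by exfalso; apply: (yN (n * m^-1)%g); rewrite iM iV -yzn zm mulgK.
- have : l' (y * z)%g <= D by case: (l'P (y * z)%g) => [[n _ ->]|[-> _]].
  by lra.
Qed.

(** * Choice of sequences and enumerations *)

Lemma dependent_function_choice (I : Type) (T : I -> Type) (P : forall i, T i -> Prop) :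
  (forall i, exists x, P i x) -> exists f : forall i, T i, forall i, P i (f i).
Proof.
by move=> h; exists (fun i => sval (cid (h i))) => i; exact: svalP.
Qed.

Lemma sequence_exists (T : Type) (P : nat -> T -> T -> Prop) (x0 : T) :
  (forall n x, exists y, P n x y) -> exists u : nat -> T, forall n, P n (u n) (u n.+1).
Proof.
move=> h; have /choice[f fP] : forall p : nat * T, exists y, P p.1 p.2 y.
  by move=> [n x]; exact: h.
exists (fix u n := if n is m.+1 then f (m, u m) else x0) => n.
exact: (fP (n, _)).
Qed.

Lemma countable_enumeration (T : Type) (x0 : T) : countable [set: T] ->
  exists g : nat -> T, forall x, exists n, g n = x.
Proof.
move=> /countable_injP[f f_inj].
have /choice[g gP] : forall n, exists x, forall y, f y = n -> x = y.
  move=> n; have [[y yn]|h] := pselect (exists y, f y = n); last first.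
    by exists x0 => y yn; exfalso; apply: h; exists y.
  by exists y => z zn; apply: f_inj; rewrite ?inE// yn zn.
by exists g => x; exists (f x); exact: gP.
Qed.

(** * Exhausting Hall's group by finite groups with lengths *)

Section hall.
Variables (R : realType) (H : groupType).
Hypothesis hall_H : hall_group H.

Definition positive_reals : set R := [set x | 0 < x].

Lemma positive_reals_capped : capped_sum_closed positive_reals.
Proof.
split=> // D x y D0 x0 y0; rewrite /positive_reals/= lt_min D0 /=.
exact: addr_gt0.
Qed.

Record hall_stage := HallStage {
  hall_fin :> finGroupType ;
  hall_len : hall_fin -> R ;
  hall_emb : hall_fin -> H ;
  hall_lenP : length_in positive_reals hall_len ;
  hall_embP : group_embedding hall_emb }.

Definition hall_next (h : H) (n : nat) (K L : hall_stage) :=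
  exists phi : K -> L, [/\ {morph phi : x y / (x * y)%g},
    forall x, hall_emb (phi x) = hall_emb x,
    forall x, hall_len (phi x) = hall_len x,
    range (@hall_emb L) h
    & forall A B : {set L},
        (forall a b, a \in A -> b \in B ->
          ~ forall x : K, hall_len ((phi x)^-1 * (b * a^-1) * phi x)%g <= n.+1%:R^-1) ->
        (n * (#|A| * #|B|) <= #|L| ^ 2)%N].

(** Local finiteness makes the subgroup generated by the stage and [h] finite. Its length is
    extended, a power is taken, and the extension property puts the power back into [H]. *)
Lemma hall_next_exists h n K : exists L, hall_next h n K L.
Proof.
have [_ lfH extH] := hall_H; have hD := positive_reals_capped.
have D0 : positive_reals !=set0 by exists 1; exact: ltr01.
pose S := smallest (@subgroup H) (range (@hall_emb K) `|` [set h]).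
have sS : subgroup S.
  have S1 (T : set H) : subgroup T -> 1%g \in T by case.
  split; first by rewrite inE => T [[T1 _] _]; move: T1; rewrite inE.
  move=> x y; rewrite !inE => Sx Sy T [sT hT].
  have [_ TB] := sT; have := TB x y; rewrite !inE; apply; [exact: Sx|exact: Sy].
have fS : finite_set S.
  apply: lfH; rewrite finite_setU; split; last exact: finite_set1.
  exact: finite_image.
have KS : range (@hall_emb K) `|` [set h] `<=` S.
  by move=> x hx T [_]; exact.
have [L0 [j [[j_inj jM] jS]]] := finite_subgroup_exists sS fS.
have /choice[i iE] : forall x : K, exists y, j y = hall_emb x.
  move=> x; have : S (hall_emb x) by apply: KS; left; exists x.
  by rewrite -jS => -[y _ yx]; exists y.
have [K_inj KM] := hall_embP K.
have i_emb : group_embedding i.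
  split; first by move=> x y xy; apply: K_inj; rewrite -!iE xy.
  by move=> x y; apply: j_inj; rewrite jM !iE KM.
have [l' [l'D l'i]] := trivial_extension hD D0 (hall_lenP K) i_emb.
have dn : positive_reals (n.+1%:R^-1 : R) by rewrite /positive_reals/= invr_gt0.
have [P [phi [lP [phiM lPD lPphi Pconc]]]] := power_extension n hD l'D dn.
have phi_emb : group_embedding phi.
  (* A length-preserving morphism is injective. *)
  split=> // x y xy; apply: (length_dist_inj hD l'D).
  by rewrite -lPphi phiM (morph_groupV phiM) xy mulVg; case: lPD => -[].
have [Phi [Phi_emb PhiE]] := extH _ _ j phi (conj j_inj jM) phi_emb.
exists (HallStage lPD Phi_emb), (phi \o i); split => /=.
- by move=> x y /=; rewrite i_emb.2 phiM.
- by move=> x; rewrite -iE PhiE.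
- by move=> x; rewrite lPphi l'i.
- have : S h by apply: KS; right.
  by rewrite -jS => -[y _ <-]; exists (phi y); rewrite // PhiE.
- move=> A B hAB; apply: Pconc => a b aA bB hx; apply: (hAB a b aA bB) => x.
  exact: hx.
Qed.

Lemma hall_stage0 : inhabited hall_stage.
Proof.
have u1 (x : {perm unit}) : x = 1%g by apply/permP => -[]; case: (x tt); rewrite perm1.
have l0 : length_in positive_reals (fun _ : {perm unit} => 0 : R).
  split; last by move=> x; rewrite (u1 x) eqxx.
  by split=> // *; rewrite addr0.
have e0 : group_embedding (fun _ : {perm unit} => 1%g : H).
  by split=> [x y _|x y]; [rewrite (u1 x) (u1 y)|rewrite mulg1].
exact: inhabits (HallStage l0 e0).
Qed.

Theorem hall_levy :
  exists G : topologicalGroupType, (G : groupType) = H /\ levy R G.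
Proof.
have [cH _ _] := hall_H.
have [g gP] := countable_enumeration (1%g : H) cH.
have [K0] := hall_stage0.
have [K KP] := sequence_exists K0 (fun n => hall_next_exists (g n) n).
have [phi phiP] := dependent_function_choice KP.
have phiM i : {morph @phi i : x y / (x * y)%g} by case: (phiP i).
have phij i x : hall_emb (phi i x) = hall_emb x by case: (phiP i).
have phil i x : hall_len (phi i x) = hall_len x by case: (phiP i).
have j_onto h : exists i, exists x : K i, hall_emb x = h.
  have [n <-] := gP h; have [_ _ _ [x _ xh] _] := phiP n.
  by exists n.+1, x.
have j_inj i : injective (@hall_emb (K i)) := (hall_embP (K i)).1.
have jM i : {morph @hall_emb (K i) : x y / (x * y)%g} := (hall_embP (K i)).2.
have trans i d (x : K i) : exists y : K (d + i)%N,
    hall_emb y = hall_emb x /\ hall_len y = hall_len x.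
  elim: d => [|d [y [yx lyx]]]; first by exists x.
  by exists (phi _ y); rewrite phij phil.
(* Two stages that contain [h] are compared in a common later one, so the length of [h] is well
   defined. *)
have /choice[l lE] : forall h, exists r, forall i (x : K i), hall_emb x = h -> hall_len x = r.
  move=> h; have [i [x xh]] := j_onto h; exists (hall_len x) => m y yh.
  have [x' [xx' <-]] := trans i m x; have [y' [yy' <-]] := trans m i y.
  move: x' xx'; rewrite addnC => x' xx'; congr hall_len; apply: j_inj.
  by rewrite xx' yy' xh.
have lj i (x : K i) : l (hall_emb x) = hall_len x by symmetry; exact: lE.
have hl i := (hall_lenP (K i)).1.
have lvl2 h h' : exists i, exists x y : K i, hall_emb x = h /\ hall_emb y = h'.
  have [i [x <-]] := j_onto h; have [m [y <-]] := j_onto h'.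
  have [x' [xx' _]] := trans i m x; have [y' [yy' _]] := trans m i y.
  move: x' xx'; rewrite addnC => x' xx'.
  by exists (i + m)%N, x', y'.
have j1 i : hall_emb (1%g : K i) = 1%g := morph_group1 (@jM i).
have jV i (x : K i) : hall_emb x^-1%g = (hall_emb x)^-1%g := morph_groupV (@jM i) x.
have l_length : length_function l.
  split; first by rewrite -(j1 0%N) lj; case: (hl 0%N).
    by move=> h; have [i [x <-]] := j_onto h; rewrite -jV !lj; case: (hl i).
  move=> h h'; have [i [x [y [<- <-]]]] := lvl2 h h'.
  by rewrite -jM !lj; case: (hl i).
have l_eq1 h : l h = 0 -> h = 1%g.
  have [i [x <-]] := j_onto h; rewrite lj => x0.
  by rewrite (length_eq1 positive_reals_capped (hall_lenP (K i)) x0) j1.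
pose X := length_metric l_length l_eq1.
pose e i (x : K i) : X := hall_emb x.
have eE i (x y : K i) : mdist (e i x) (e i y) = hall_len (x^-1 * y)%g.
  by rewrite -lj jM jV.
have leq1 i (x : K i) : hall_len x = 0 -> x = 1%g.
  exact: length_eq1 positive_reals_capped (hall_lenP (K i)).
have conc i : forall (A B : {set K i.+1}), (forall a b, a \in A -> b \in B ->
    ~ forall x : K i, hall_len ((phi i x)^-1 * (b * a^-1) * phi i x)%g <= i.+1%:R^-1) ->
    (i * (#|A| * #|B|) <= #|K i.+1| ^ 2)%N by case: (phiP i).
have [alpha [alpha_inj alphaM alpha_eq alphaE alpha_conc]] :=
  @chain_concentration R X K (fun i => @hall_len (K i)) e phi leq1 eE phiM
    phij j_onto conc.
(* [lambda] is the left translation action of [H] on [X], along which the topology is pulled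
   back. *)
have /choice[lambda lambdaE] : forall h, exists f : isometry_group X,
    forall i (x : K i), hall_emb x = h -> alpha i x = f.
  move=> h; have [i [x xh]] := j_onto h; exists (alpha i x) => m y yh.
  by apply: alpha_eq; rewrite /e xh yh.
have lambdaM : {morph lambda : x y / (x * y)%g}.
  move=> h h'; have [i [x [y [xh yh]]]] := lvl2 h h'.
  rewrite -(lambdaE h _ x xh) -(lambdaE h' _ y yh) -alphaM.
  by rewrite -(lambdaE _ _ (x * y)%g)// jM xh yh.
have lambda_inj : injective lambda.
  move=> h h'; have [i [x [y [xh yh]]]] := lvl2 h h'.
  rewrite -(lambdaE h _ x xh) -(lambdaE h' _ y yh) => /alpha_inj xy.
  by rewrite -xh -yh xy.
pose G := initial_topgroup lambdaM lambda_inj.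
exists G; split; first exact: initial_topgroupE.
pose j i (x : K i) : G := hall_emb x.
have jM' i : {morph j i : x y / (x * y)%g} by exact: jM.
exists (fun i => range (j i)), (fun i => uniform_probability R (j i)); split; last first.
  by move=> i; apply: uniform_normalized_haar; exact: jM'.
apply: concentration_levy_sequence => //.
- by move=> i _ [x _ <-]; exists (phi i x) => //; exact: phij.
- move=> O [h Oh] _; exists h; split => //.
  by have [i [x xh]] := j_onto h; exists i => //; exists x.
- move=> V M [B oB BV] V1.
  have B1 : B 1%g.
    by rewrite -(morph_group1 lambdaM); move: V1; rewrite -BV.
  apply: filterS (alpha_conc B M oB B1) => i hi A A' hA; apply: hi => a b aA bA' Bab.
  apply: (hA a b aA bA'); rewrite -BV /= -(lambdaE _ _ (b * a^-1)%g)//.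
Qed.

End hall.

(** * Urysohn spaces *)

Section urysohn.
Variables (R : realType) (Delta : set R) (U : metricType R).
Hypothesis Delta_capped : capped_sum_closed Delta.
Hypothesis Delta_neq0 : Delta !=set0.
Hypothesis Delta_small : forall eps, 0 < eps -> exists2 d, Delta d & d <= eps.
Hypothesis urysohn_U : urysohn_space Delta U.

Record urysohn_stage := UrysohnStage {
  ury_fin :> finGroupType ;
  ury_len : ury_fin -> R ;
  ury_emb : ury_fin -> U ;
  ury_lenP : length_in Delta ury_len ;
  ury_embP : forall x y, mdist (ury_emb x) (ury_emb y) = ury_len (x^-1 * y)%g }.

Definition ury_sub (K L : urysohn_stage) (phi : K -> L) :=
  {morph phi : x y / (x * y)%g} /\ forall x, ury_emb (phi x) = ury_emb x.

Lemma embed_length (K : finGroupType) (l : K -> R) : length_in Delta l ->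
  exists e : K -> U, forall x y, mdist (e x) (e y) = l (x^-1 * y)%g.
Proof.
move=> hl; have [_ _ univ _] := urysohn_U.
have l_eq1 x : l x = 0 -> x = 1%g by exact: length_eq1 Delta_capped hl.
have [|f fE] := univ (length_metric hl.1 l_eq1) (@finite_finset K setT).
  move=> x y xy; apply: hl.2; apply: contra_neq xy => xy1.
  by rewrite -[LHS]/(l ((x : K)^-1 * y)%g) xy1; case: hl.1.
by exists f => x y; rewrite fE.
Qed.

(** Universality gives a copy of [L] in [U]; ultrahomogeneity moves it so that it prolongs [e] and
    sends [z] to [u]. *)
Lemma extend_embedding (K L : finGroupType) (l : K -> R) (l' : L -> R)
    (e : K -> U) (phi : K -> L) (z : L) (u : U) :
  length_in Delta l' ->
  (forall x y, mdist (e x) (e y) = l (x^-1 * y)%g) ->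
  {morph phi : x y / (x * y)%g} -> (forall k, l' (phi k) = l k) ->
  (forall k, l' ((phi k)^-1 * z)%g = mdist (e k) u) ->
  exists e' : L -> U, [/\ forall x y, mdist (e' x) (e' y) = l' (x^-1 * y)%g,
    forall k, e' (phi k) = e k & e' z = u].
Proof.
move=> hl' eE phiM l'phi l'z; have [_ _ _ ultra] := urysohn_U.
have [f fE] := embed_length hl'.
have phiV k := morph_groupV phiM k.
have fphi k k' : mdist (f (phi k)) (f (phi k')) = mdist (e k) (e k').
  by rewrite fE eE -phiV -phiM l'phi.
have fz k : mdist (f (phi k)) (f z) = mdist (e k) u by rewrite fE l'z.
(* Matching distances make this partial map well defined even when [z] lies in the range of
   [phi]. *)
have /choice[p pE] : forall y, exists v,
    (forall k, y = f (phi k) -> v = e k) /\ (y = f z -> v = u).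
  move=> y; have [[k ->]|yK] := pselect (exists k, y = f (phi k)).
    exists (e k); split=> [k' kk'|kz]; apply: mdist_positivity.
      by rewrite -fphi kk' mdistxx.
    by rewrite -fz kz mdistxx.
  exists u; split=> // k yk; by case: yK; exists k.
have pphi k : p (f (phi k)) = e k by apply: (pE _).1.
have pz : p (f z) = u by apply: (pE _).2.
pose A := f @` (range phi `|` [set z]).
have fA : finite_set A by apply: finite_image; exact: finite_finset.
have [|g gE] := ultra A p fA.
  move=> _ _ /set_mem[x hx <-] /set_mem[y hy <-].
  case: hx => [[k _ <-]|->]; case: hy => [[k' _ <-]|->].
  - by rewrite !pphi fphi.
  - by rewrite pphi pz fz.
  - by rewrite pz pphi metric_sym -fz metric_sym.
  - by rewrite !mdistxx.
exists (g \o f); split=> [x y|k|] /=.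
- by rewrite isometryP fE.
- by rewrite gE ?pphi//; apply: mem_set; exists (phi k) => //; left; exists k.
- by rewrite gE ?pz//; apply: mem_set; exists z => //; right.
Qed.

Lemma ury_sub_id (K : urysohn_stage) : ury_sub (id : K -> K).
Proof. by []. Qed.

Lemma ury_sub_comp (K L M : urysohn_stage) (phi : K -> L) (psi : L -> M) :
  ury_sub phi -> ury_sub psi -> ury_sub (psi \o phi).
Proof.
move=> [phiM phiE] [psiM psiE]; split=> [x y|x] /=.
  by rewrite phiM psiM.
by rewrite psiE phiE.
Qed.

(** The new element [t] is given the distances of [u] to [K]. The triangle inequality in [U] makes
    them exact, so [t] can be placed at [u]. *)
Lemma ury_add_point (K : urysohn_stage) (u : U) :
  exists (L : urysohn_stage) (phi : K -> L),
    ury_sub phi /\ range (@ury_emb L) u.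
Proof.
have [uK|uK] := pselect (range (@ury_emb K) u).
  by exists K, id; split=> //; exact: ury_sub_id.
have hl := ury_lenP K; have l1 : ury_len (1%g : K) = 0 by case: hl.1.
pose s := [seq (k, 1%g : K, mdist (ury_emb k) u) | k <- enum K].
have sP x : x \in s -> exists k, x = (k, 1%g, mdist (ury_emb k) u).
  by move=> /mapP[k _ ->]; exists k.
have [||L [phi [t [l' [phiM l'D l'phi l't]]]]] :=
    @table_extension R Delta K (@ury_len K) s Delta_capped Delta_neq0 hl.
- move=> x /sP[k ->] /=; have [_ DU _ _] := urysohn_U; apply: DU.
  by apply/eqP => /mdist_positivity ku; apply: uK; exists k.
- move=> x y /sP[k ->] /sP[k' ->] /=.
  rewrite mulVg l1 subr0 ger0_norm ?(length_ge0 _ hl.1)// -ury_embP.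
  by rewrite [mdist (ury_emb k') u]metric_sym metric_triangle.
have phi1 := morph_group1 phiM.
have l'tE k : l' ((phi k)^-1 * t)%g = mdist (ury_emb k) u.
  have ks : (k, 1%g, mdist (ury_emb k) u) \in s by apply/mapP; exists k; rewrite ?mem_enum.
  have [_] := l't _ ks; rewrite /= phi1 mulg1; apply => y /sP[k' ->].
  by rewrite /via /= mulVg l1 addr0 -ury_embP metric_triangle.
have [e' [e'E e'phi e't]] := extend_embedding l'D (@ury_embP K) phiM l'phi l'tE.
exists (UrysohnStage l'D e'E), phi; split; first by split.
by exists t.
Qed.

Lemma ury_add_points (K : urysohn_stage) (s : seq U) :
  exists (L : urysohn_stage) (phi : K -> L),
    ury_sub phi /\ forall u, u \in s -> range (@ury_emb L) u.
Proof.
elim: s => [|u s [L [phi [phiS Ls]]]]; first by exists K, id; split=> //; exact: ury_sub_id.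
have [M [psi [psiS Mu]]] := ury_add_point L u.
exists M, (psi \o phi); split; first exact: ury_sub_comp.
move=> v; rewrite inE => /predU1P[->//|/Ls[x _ <-]].
by exists (psi x) => //; exact: psiS.2.
Qed.

(** * Realizing partial isometries inside a stage *)

Definition partial_isometry (s : seq (U * U)) := forall p q, p \in s -> q \in s ->
  mdist p.1 q.1 = mdist p.2 q.2.

(** The point to be added is taken to be the image of the identity, which is already there. *)
Lemma ury_no_point (K : urysohn_stage) (L : finGroupType) (l' : L -> R) (phi : K -> L) :
  length_in Delta l' -> {morph phi : x y / (x * y)%g} ->
  (forall k, l' (phi k) = ury_len k) ->
  exists e' : L -> U, (forall x y, mdist (e' x) (e' y) = l' (x^-1 * y)%g) /\
    forall k, e' (phi k) = ury_emb k.
Proof.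
move=> l'D phiM l'phi.
have phi1 := morph_group1 phiM.
have h k : l' ((phi k)^-1 * phi 1%g)%g = mdist (ury_emb k) (ury_emb (1%g : K)).
  rewrite phi1 mulg1 ury_embP mulg1; have [[_ l'V _] _] := l'D.
  by rewrite l'V l'phi; case: (ury_lenP K) => -[_ -> _] _.
have [e' [e'E e'phi _]] := extend_embedding l'D (@ury_embP K) phiM l'phi h.
by exists e'.
Qed.

(** The new element must move the first point of each pair to within a small [d] in [Delta] of the
    second; these demands are compatible because [s] preserves distances. *)
Lemma ury_add_isometry (K : urysohn_stage) (s : seq (U * U)) (eps : R) :
  0 < eps -> partial_isometry s ->
  exists (L : urysohn_stage) (phi : K -> L) (t : L), ury_sub phi /\
    forall x y : K, (ury_emb x, ury_emb y) \in s ->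
      mdist (ury_emb (t * phi x)%g) (ury_emb y) <= eps.
Proof.
move=> eps0 sI; have hl := ury_lenP K; have [d dd deps] := Delta_small eps0.
have d0 : 0 < d by exact: Delta_capped.1.
pose s' := [seq (p.2, p.1, d) | p <- enum {: K * K} & (ury_emb p.1, ury_emb p.2) \in s].
have s'P x : x \in s' -> exists p : K * K,
    (ury_emb p.1, ury_emb p.2) \in s /\ x = (p.2, p.1, d).
  by move=> /mapP[p]; rewrite mem_filter => /andP[ps _] ->; exists p.
have [||L [phi [t [l' [phiM l'D l'phi l't]]]]] :=
    @table_extension R Delta K (@ury_len K) s' Delta_capped Delta_neq0 hl.
- by move=> x /s'P[p [_ ->]].
- move=> x y /s'P[p [ps ->]] /s'P[q [qs ->]] /=.
  by rewrite -!ury_embP (sI _ _ ps qs) subrr normr0 addr_ge0// ltW.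
have [e' [e'E e'phi]] := ury_no_point l'D phiM l'phi.
exists (UrysohnStage l'D e'E), phi, t; split; first by split.
move=> x y xys /=; rewrite -e'phi e'E (length_dist_sym _ _ l'D.1) mulgA.
apply: le_trans deps; apply: (l't (y, x, d) _).1.
by apply/mapP; exists (x, y) => //; rewrite mem_filter xys mem_enum.
Qed.

(** [n.+1%:R^-1] need not lie in [Delta]; an element of [Delta] below it takes its place. *)
Lemma ury_power (K : urysohn_stage) (n : nat) :
  exists (L : urysohn_stage) (phi : K -> L), ury_sub phi /\
    forall A B : {set L},
      (forall a b, a \in A -> b \in B ->
        ~ forall x : K, ury_len ((phi x)^-1 * (b * a^-1) * phi x)%g <= n.+1%:R^-1) ->
      (n * (#|A| * #|B|) <= #|L| ^ 2)%N.
Proof.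
have n0 : 0 < n.+1%:R^-1 :> R by rewrite invr_gt0.
have [d dd dn] := Delta_small n0.
have [L [phi [l' [phiM l'D l'phi conc]]]] := power_extension n Delta_capped (ury_lenP K) dd.
have [e' [e'E e'phi]] := ury_no_point l'D phiM l'phi.
exists (UrysohnStage l'D e'E), phi; split; first by split.
move=> A B hAB; apply: conc => a b aA bB hx; apply: (hAB a b aA bB) => x.
exact: le_trans (hx x) dn.
Qed.

(** The pair of [s] and [m] is a task taken from an enumeration of all lists, so [s] need not be a
    partial isometry. *)
Definition ury_next (s : seq (U * U)) (m n : nat) (K L : urysohn_stage) :=
  exists phi : K -> L, [/\ ury_sub phi,
    forall p, p \in s -> range (@ury_emb L) p.1,
    partial_isometry s -> exists t : L, forall x p, p \in s -> ury_emb x = p.1 ->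
      mdist (ury_emb (t * x)%g) p.2 <= m.+1%:R^-1
    & forall A B : {set L},
      (forall a b, a \in A -> b \in B ->
        ~ forall x : K, ury_len ((phi x)^-1 * (b * a^-1) * phi x)%g <= n.+1%:R^-1) ->
      (n * (#|A| * #|B|) <= #|L| ^ 2)%N].

Lemma ury_emb_inj (K : urysohn_stage) : injective (@ury_emb K).
Proof.
move=> x y xy; apply: (length_dist_inj Delta_capped (ury_lenP K)).
by rewrite -ury_embP xy mdistxx.
Qed.

(** The power comes last, so that the concentration bound holds in the final group; closeness under
    conjugation by [K2] implies closeness under conjugation by [K]. *)
Lemma ury_next_exists s m n K : exists L, ury_next s m n K L.
Proof.
have [K1 [phi1 [phi1S K1s]]] := ury_add_points K ([seq p.1 | p <- s] ++ [seq p.2 | p <- s]).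
have m0 : 0 < m.+1%:R^-1 :> R by rewrite invr_gt0.
have [K2 [phi2 [t [phi2S K2t]]]] : exists (K2 : urysohn_stage) (phi2 : K1 -> K2) (t : K2),
    ury_sub phi2 /\ (partial_isometry s -> forall x y : K1, (ury_emb x, ury_emb y) \in s ->
      mdist (ury_emb (t * phi2 x)%g) (ury_emb y) <= m.+1%:R^-1).
  have [sI|sI] := pselect (partial_isometry s).
    have [K2 [phi2 [t [phi2S h]]]] := ury_add_isometry K1 m0 sI.
    by exists K2, phi2, t.
  by exists K1, id, 1%g; split=> //; exact: ury_sub_id.
have [L [phi3 [phi3S conc]]] := ury_power K2 n.
have K1L p : p \in s -> exists2 xy : K1 * K1, p.1 = ury_emb xy.1 & p.2 = ury_emb xy.2.
  move=> ps; have [|x _ xp] := K1s p.1.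
    by rewrite mem_cat map_f.
  have [|y _ yp] := K1s p.2.
    by rewrite mem_cat map_f ?orbT.
  by exists (x, y).
exists L, (phi3 \o (phi2 \o phi1)); split.
- by apply: ury_sub_comp => //; exact: ury_sub_comp.
- move=> p /K1L[[x y] /= -> _]; exists (phi3 (phi2 x)) => //.
  by rewrite phi3S.2 phi2S.2.
- move=> sI; exists (phi3 t) => x [p1 p2] ps /= xp.
  have [[x0 y0] /= p1E p2E] := K1L _ ps.
  have -> : x = phi3 (phi2 x0).
    by apply: ury_emb_inj; rewrite xp p1E phi3S.2 phi2S.2.
  rewrite -phi3S.1 phi3S.2 p2E; apply: K2t => //.
  by rewrite -p1E -p2E.
move=> A B hAB; apply: conc => a b aA bB hx; apply: (hAB a b aA bB) => x.
exact: hx.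
Qed.

Lemma trivial_length : exists (K : finGroupType) (l : K -> R), length_in Delta l.
Proof.
exists {perm unit}, (fun=> 0); split.
  by split=> // *; rewrite addr0.
by move=> x /eqP[]; apply/permP => -[]; case: (x tt); rewrite perm1.
Qed.

Theorem urysohn_strong_levy : strong_levy R (isometry_group U).
Proof.
have [cU _ _ _] := urysohn_U.
have [K0 [l0 l0D]] := trivial_length; have [e0 e0E] := embed_length l0D.
have [g gP] := countable_enumeration (e0 1%g) cU.
(* Every task, a list of pairs of points with a precision, is assigned to some step. *)
pose dec (n : nat) : seq (U * U) * nat :=
  if choice.unpickle n is Some (c, m) then ([seq (g p.1, g p.2) | p <- c], m) else ([::], 0%N).
have decP (s : seq (U * U)) m : exists n, dec n = (s, m).
  suff [c cs] : exists c : seq (nat * nat), [seq (g p.1, g p.2) | p <- c] = s.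
    by exists (choice.pickle (c, m)); rewrite /dec choice.pickleK cs.
  elim: s => [|[u v] s [c <-]]; first by exists [::].
  by have [a <-] := gP u; have [b <-] := gP v; exists ((a, b) :: c).
have [K KP] := sequence_exists (UrysohnStage l0D e0E)
  (fun n => ury_next_exists (dec n).1 (dec n).2 n).
have [phi phiP] := dependent_function_choice KP.
have phiM i : {morph phi i : x y / (x * y)%g} by case: (phiP i) => -[].
have phie i x : ury_emb (phi i x) = ury_emb x by case: (phiP i) => -[].
have len_eq1 i (x : K i) : ury_len x = 0 -> x = 1%g.
  exact: length_eq1 Delta_capped (ury_lenP (K i)).
have e_onto u : exists i, exists x : K i, ury_emb x = u.
  (* The task [(u, u)] puts [u] into a stage, so the stages exhaust [U]. *)
  have [n nE] := decP [:: (u, u)] 0%N; have [_ h _ _] := phiP n.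
  by have [|x _ xu] := h (u, u); [rewrite nE inE|exists n.+1, x].
have conc i : forall (A B : {set K i.+1}), (forall a b, a \in A -> b \in B ->
    ~ forall x : K i, ury_len ((phi i x)^-1 * (b * a^-1) * phi i x)%g <= i.+1%:R^-1) ->
    (i * (#|A| * #|B|) <= #|K i.+1| ^ 2)%N by case: (phiP i).
have [alpha [alpha_inj alphaM alpha_eq alphaE alpha_conc]] :=
  @chain_concentration R U K (fun i => @ury_len (K i)) (fun i => @ury_emb (K i))
    phi len_eq1 (fun i => @ury_embP (K i)) phiM phie e_onto conc.
exists (fun i => range (alpha i)), (fun i => uniform_probability R (alpha i)); split; last first.
  move=> i; split; first exact: finite_range_alpha.
  by apply: uniform_normalized_counting; exact: alpha_inj.
apply: concentration_levy_sequence => //.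
- by move=> i _ [x _ <-]; exists (phi i x) => //; apply: alpha_eq; exact: phie.
- move=> O [h Oh] oO; have [s [eps [eps0 sO]]] := isometry_basic_nbhs oO Oh.
  pose m := Num.bound eps^-1.
  have meps : m.+1%:R^-1 < eps.
    have epsV : 0 <= eps^-1 by rewrite invr_ge0 ltW.
    rewrite invf_plt ?posrE//; apply: lt_le_trans (archi_boundP epsV) _.
    by rewrite ler_nat.
  (* The step for this task supplies an element [t] that agrees with [h] on [s] up to less than
     [eps], which proves density. *)
  have [n nE] := decP [seq (x, h x) | x <- s] m.
  have [_ pts iso _] := phiP n; move: pts iso; rewrite nE /= => pts iso.
  have [|t tP] := iso.
    by move=> _ _ /mapP[x _ ->] /mapP[y _ ->] /=; rewrite isometryP.
  exists (alpha _ t); split; last by exists n.+1 => //; exists t.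
  apply: sO => x xs; have xs' : (x, h x) \in [seq (x, h x) | x <- s] by exact: map_f.
  have [y _ /= yx] := pts _ xs'.
  rewrite -yx alphaE metric_sym; apply: le_lt_trans meps; rewrite yx.
  exact: (tP y (x, h x) xs' yx).
Qed.

End urysohn.

(** * From zero infimum to arbitrarily small distances *)

Lemma inf0_small (R : realType) (Delta : set R) : Delta !=set0 -> inf Delta = 0 ->
  forall eps, 0 < eps -> exists2 d, Delta d & d <= eps.
Proof.
move=> Delta0 inf0 eps eps0; apply: contrapT => h.
suff : eps <= inf Delta by rewrite inf0 leNgt eps0.
apply: lb_le_inf => // d dd; rewrite leNgt; apply/negP => de.
by apply: h; exists d => //; exact: ltW.
Qed.

Theorem corollary6p7 (R : realType) :
  (forall Delta : set R,
     countable Delta -> distance_value_set Delta -> inf Delta = 0 ->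
     forall U : metricType R, urysohn_space Delta U -> strong_levy R (isometry_group U)) /\
  (forall H : groupType, hall_group H ->
     exists G : topologicalGroupType, (G : groupType) = H /\ levy R G).
Proof.
split=> [Delta _ hDelta inf0 U hU|H hH]; last exact: hall_levy.
have Delta0 : Delta !=set0 by case: hDelta.
apply: urysohn_strong_levy hU => //; last exact: inf0_small.
exact: distance_value_set_capped.
Qed.
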